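(* Provably in ZFC, the following three statements are equivalent: $\mathbf{Det}(\Sigma^1_1)$; $\mathbf{Det}(\mathbf{CFL}_\omega)$; $\mathbf{Det}(\mathbf{r}\text{-}\mathbf{BCL}(1)_\omega)$. In particular, determinacy of all Gale–Stewart games whose winning sets are accepted by real-time Büchi $1$-counter automata is equivalent to determinacy of all Gale–Stewart games with effective analytic winning sets.
   Context: All alphabets are finite. Gale–Stewart game: for $A\subseteq X^\omega$, in $G(A)$ Players 1 and 2 alternately write letters of $X$ (Player 1 first), producing $x=a_1b_1a_2b_2\cdots$; Player 1 wins iff $x\in A$. $G(A)$ is determined if one player has a winning strategy. For a class $\mathcal C$ of $\omega$-languages, $\mathbf{Det}(\mathcal C)$ is the sentence ''every game $G(A)$ with $A\subseteq X^\omega$ in $\mathcal C$ is determined''. A Büchi $k$-counter automaton is $(K,\Sigma,\Delta,q_0,F)$ with $\Delta\subseteq K\times(\Sigma\cup\{\lambda\})\times\{0,1\}^k\times K\times\{0,1,-1\}^k$: counters hold naturals; a transition $(q,a,i_1,\dots,i_k,q',j_1,\dots,j_k)$ applies in configuration $(q,c_1,\dots,c_k)$ when $i_m=0$ iff $c_m=0$, reads $a$ (nothing if $a=\lambda$), and moves to $(q',c_1+j_1,\dots,c_k+j_k)$ (zero counters are not decremented); it accepts $\sigma$ iff some run from $(q_0,0,\dots,0)$ reading $\sigma$ visits $F$ infinitely often. It is real-time if no transition has $a=\lambda$. $\mathbf{r}\text{-}\mathbf{BCL}(k)_\omega$ is the class of $\omega$-languages accepted by real-time Büchi $k$-counter automata;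 $\mathbf{CFL}_\omega$ is the class accepted by Büchi pushdown automata. $\Sigma^1_1$ is the class of effective analytic sets: $L\subseteq X^\omega$ such that for some recursive $R\subseteq\mathbb N\times\{0,1\}^*\times X^*$, $L=\{\sigma:\exists\tau\in\{0,1\}^\omega\ \forall n\ \exists m\ (n,\tau[m],\sigma[m])\in R\}$, where $y[m]$ is the length-$m$ prefix. *)

(* Defs.v *)
From mathcomp Require Import all_boot.
Set Implicit Arguments. Unset Strict Implicit. Unset Printing Implicit Defensive.

Definition oword (X : Type) := nat -> X.
Definition olang (X : Type) := oword X -> Prop.
Definition oclass := forall X : finType, olang X -> Prop.

Definition prefix (X : Type) (y : nat -> X) (m : nat) : seq X := mkseq y m.

Definition strategy (X : Type) := seq X -> X.

Fixpoint history (X : Type) (s1 s2 : strategy X) (n : nat) : seq X :=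
  if n is n'.+1 then
    let h := history s1 s2 n' in rcons h ((if odd n' then s2 else s1) h)
  else [::].

Definition play (X : Type) (s1 s2 : strategy X) : oword X :=
  fun n => (if odd n then s2 else s1) (history s1 s2 n).

Definition P1_wins (X : Type) (A : olang X) (s1 : strategy X) : Prop :=
  forall s2 : strategy X, A (play s1 s2).
Definition P2_wins (X : Type) (A : olang X) (s2 : strategy X) : Prop :=
  forall s1 : strategy X, ~ A (play s1 s2).

Definition determined (X : Type) (A : olang X) : Prop :=
  (exists s1, P1_wins A s1) \/ (exists s2, P2_wins A s2).

Definition Det (C : oclass) : Prop :=
  forall (X : finType), inhabited X -> forall A : olang X, C X A -> determined A.

Inductive cdir := CDec | CStay | CInc.

Definition cupd (c : nat) (d : cdir) : nat :=
  match d with CDec => c.-1 | CStay => c | CInc => c.+1 end.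
(* c.-1 is truncated: zero counters are not decremented *)

(* Transitions (q, a, i_1..i_k, q', j_1..j_k) with a a letter (real-time: no lambda). *)
Record rt_counter_aut (X : finType) (k : nat) := RTCA {
  rca_state : finType;
  rca_delta : rca_state -> X -> {ffun 'I_k -> bool} -> rca_state ->
              {ffun 'I_k -> cdir} -> Prop;
  rca_init : rca_state;
  rca_final : {set rca_state} }.

Definition rca_step (X : finType) (k : nat) (M : rt_counter_aut X k) (a : X)
  (q : rca_state M) (c : 'I_k -> nat) (q' : rca_state M) (c' : 'I_k -> nat) : Prop :=
  exists (i : {ffun 'I_k -> bool}) (j : {ffun 'I_k -> cdir}),
    @rca_delta X k M q a i q' j /\
    forall m : 'I_k, i m = (c m != 0) /\ c' m = cupd (c m) (j m).

Definition rca_accepts (X : finType) (k : nat) (M : rt_counter_aut X k) (s : oword X)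
  : Prop :=
  exists (rq : nat -> rca_state M) (rc : nat -> 'I_k -> nat),
    rq 0 = @rca_init X k M /\ (forall m, rc 0 m = 0) /\
    (forall n, @rca_step X k M (s n) (rq n) (rc n) (rq n.+1) (rc n.+1)) /\
    (forall N, exists n, N <= n /\ rq n \in @rca_final X k M).

Definition rBCL (k : nat) : oclass := fun X L =>
  exists M : rt_counter_aut X k, forall s, L s <-> rca_accepts M s.

(* delta: finite list of transitions (q, a or lambda(None), Z, q', w):
   in state q with top of stack Z, reading a (or nothing), go to q' and
   replace Z by the word w. *)
Record bpda (X : finType) := BPDA {
  pd_state : finType;
  pd_stack : finType;
  pd_delta : seq (pd_state * option X * pd_stack * pd_state * seq pd_stack);
  pd_init : pd_state;
  pd_bottom : pd_stack;
  pd_final : {set pd_state} }.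

Definition pd_step (X : finType) (M : bpda X) (a : option X)
  (q : pd_state M) (g : seq (pd_stack M)) (q' : pd_state M) (g' : seq (pd_stack M))
  : Prop :=
  exists Z rest w, g = Z :: rest /\ (q, a, Z, q', w) \in @pd_delta X M /\ g' = w ++ rest.

Definition pd_accepts (X : finType) (M : bpda X) (s : oword X) : Prop :=
  exists (rq : nat -> pd_state M) (rs : nat -> seq (pd_stack M)) (pos : nat -> nat),
    rq 0 = @pd_init X M /\ rs 0 = [:: @pd_bottom X M] /\ pos 0 = 0 /\
    (forall n,
       (pos n.+1 = pos n /\ @pd_step X M None (rq n) (rs n) (rq n.+1) (rs n.+1)) \/
       (pos n.+1 = (pos n).+1 /\
          @pd_step X M (Some (s (pos n))) (rq n) (rs n) (rq n.+1) (rs n.+1))) /\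
    (forall m, exists n, m <= pos n) /\
    (forall N, exists n, N <= n /\ rq n \in @pd_final X M).

Definition CFLw : oclass := fun X L =>
  exists M : bpda X, forall s, L s <-> pd_accepts M s.

Inductive mu : Type :=
| MZero | MSucc | MProj (i : nat) | MComp (f : mu) (gs : seq mu)
| MPrec (f g : mu) | MMin (f : mu).

Inductive mu_eval : mu -> seq nat -> nat -> Prop :=
| evZero xs : mu_eval MZero xs 0
| evSucc xs : mu_eval MSucc xs (head 0 xs).+1
| evProj i xs : mu_eval (MProj i) xs (nth 0 xs i)
| evComp f gs xs ys y :
    mu_evals gs xs ys -> mu_eval f ys y -> mu_eval (MComp f gs) xs y
| evPrec0 f g xs y : mu_eval f xs y -> mu_eval (MPrec f g) (0 :: xs) y
| evPrecS f g n xs r y :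
    mu_eval (MPrec f g) (n :: xs) r -> mu_eval g (n :: r :: xs) y ->
    mu_eval (MPrec f g) (n.+1 :: xs) y
| evMin f xs n :
    mu_eval f (n :: xs) 0 ->
    (forall m, m < n -> exists y, y <> 0 /\ mu_eval f (m :: xs) y) ->
    mu_eval (MMin f) xs n
with mu_evals : seq mu -> seq nat -> seq nat -> Prop :=
| evsNil xs : mu_evals [::] xs [::]
| evsCons g gs xs y ys :
    mu_eval g xs y -> mu_evals gs xs ys -> mu_evals (g :: gs) xs (y :: ys).

Definition recursive_nat (P : nat -> Prop) : Prop :=
  exists e : mu, forall x,
    (P x -> mu_eval e [:: x] 1) /\ (~ P x -> mu_eval e [:: x] 0).

Definition pairn (a b : nat) : nat := (a + b) * (a + b).+1 %/ 2 + b.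
Fixpoint code_seq (l : seq nat) : nat :=
  if l is a :: l' then (pairn a (code_seq l')).+1 else 0.
Definition code_letter (X : finType) (x : X) : nat := val (enum_rank x).
Definition code_triple (X : finType) (n : nat) (u : seq bool) (w : seq X) : nat :=
  pairn n (pairn (code_seq (map nat_of_bool u)) (code_seq (map (@code_letter X) w))).

Definition Sigma11 : oclass := fun X L =>
  exists R : nat -> Prop, recursive_nat R /\
    forall s : oword X,
      L s <-> exists t : nat -> bool, forall n, exists m,
                R (code_triple n (prefix t m) (prefix s m)).

(* Main.v *)
(** Both [rBCL 1 <= CFLw] and [CFLw <= Sigma11] are inclusions of classes, so the work is in
    reducing a [Sigma11] game to a game for a real-time one-counter automaton.

    Write the winning set as "some [t] makes [lbl (t[m+1], s[m])] true for infinitely many [m]", with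
    [lbl] recursive.  In the new game Player 2 must write the run of a deterministic counter machine
    which, between two rounds of the original game, lists the labels of all binary words of the
    current length.  Configurations are written in unary, so that any mistake, or a refusal to go on,
    is found by a nondeterministic automaton with one counter, which compares one register with its
    source in the previous configuration; Player 2 then loses.  If the listing is right, the automaton
    uses its counter as a pointer into it: if the two sons of a node with [r] nodes listed after it
    come at the places [2 r] and [2 r + 1] of the next level, then counting the nodes that remain
    after the chosen one prepares the choice of its son.  The branch [t] is thereby guessed by the
    automaton and never disclosed in the play, and a winning strategy of either player in the new
    game yields one in the original game. *)

Require Import Defs.
From HB Require Import structures.
From mathcomp Require Import all_boot zify.
From mathcomp.classical Require Import boolp.
Set Implicit Arguments. Unset Strict Implicit. Unset Printing Implicit Defensive.

(** * Computable functions on encoded data *)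

(** Acceptance is existential and means a win of Player 1, so it is Player 1 who profits from an
    error; this is why the computation is entrusted to Player 2. One counter suffices because a run
    commits itself at the start, through a union of automata, either to exposing one error or to
    following one branch. The branch has to stay hidden: [t] may depend on the whole infinite play,
    so Player 1 could not be asked to write it while the play goes on. The labels of a level, on the
    contrary, are computable from the letters already played. The condition on infinitely many [m]
    comes from treating the requirements [exists m, R (code_triple n ...)] for one [n] after the
    other: a label is true when the current requirement has been witnessed. Strategies are
    transferred by playing against an opponent whose complete sequence of letters is fixed in
    advance; the reply in round [m] depends only on the letters already known, so the unknown ones
    may be filled in arbitrarily. *)

Definition computes1 (e : mu) (f : nat -> nat) := forall x, mu_eval e [:: x] (f x).
Definition computes2 (e : mu) (f : nat -> nat -> nat) :=
  forall x y, mu_eval e [:: x; y] (f x y).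

Lemma mu_comp1 f g xs y z :
  mu_eval g xs y -> mu_eval f [:: y] z -> mu_eval (MComp f [:: g]) xs z.
Proof. by move=> gy fz; apply: evComp fz; apply: evsCons gy (evsNil _). Qed.

Lemma mu_comp2 f g1 g2 xs y1 y2 z :
  mu_eval g1 xs y1 -> mu_eval g2 xs y2 -> mu_eval f [:: y1; y2] z ->
  mu_eval (MComp f [:: g1; g2]) xs z.
Proof.
move=> gy1 gy2 fz; apply: evComp fz.
by apply: evsCons gy1 _; apply: evsCons gy2 (evsNil _).
Qed.

Definition mu_add := MPrec (MProj 0) (MComp MSucc [:: MProj 1]).
Lemma mu_addP : computes2 mu_add addn.
Proof.
move=> x y; elim: x => [|x IH]; first exact/evPrec0/(evProj 0).
by apply: (evPrecS IH); apply: mu_comp1; [exact: (evProj 1)|exact: evSucc].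
Qed.

Definition mu_pred := MPrec MZero (MProj 0).
Lemma mu_predP : computes1 mu_pred predn.
Proof.
elim=> [|x IH]; first exact/evPrec0/evZero.
by apply: (evPrecS IH); exact: (evProj 0).
Qed.

(** [MPrec] recurses on its first argument, so truncated subtraction comes out with its arguments
    exchanged. *)
Definition mu_rsub := MPrec (MProj 0) (MComp mu_pred [:: MProj 1]).
Lemma mu_rsubP : computes2 mu_rsub (fun x y => y - x).
Proof.
move=> x y; elim: x => [|x IH]; first by rewrite subn0; exact/evPrec0/(evProj 0).
apply: (evPrecS IH); apply: mu_comp1; first exact: (evProj 1).
by rewrite subnS; exact: mu_predP.
Qed.

Definition tri n := (n * n.+1) %/ 2.
Lemma triS n : tri n.+1 = n.+1 + tri n.
Proof. by rewrite /tri (_ : n.+1 * n.+2 = n.+1 * 2 + n * n.+1) ?divnMDl //; nia. Qed.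

Definition mu_tri :=
  MPrec MZero (MComp mu_add [:: MComp MSucc [:: MProj 0]; MProj 1]).
Lemma mu_triP : computes1 mu_tri tri.
Proof.
elim=> [|x IH]; first exact/evPrec0/evZero.
apply: (evPrecS IH); apply: mu_comp2; last by rewrite triS; exact: mu_addP.
  by apply: mu_comp1; [exact: (evProj 0)|exact: evSucc].
exact: (evProj 1).
Qed.

Lemma pairnE a b : pairn a b = tri (a + b) + b.
Proof. by []. Qed.

Definition mu_pair := MComp mu_add [:: MComp mu_tri [:: mu_add]; MProj 1].
Lemma mu_pairP : computes2 mu_pair pairn.
Proof.
move=> x y; apply: mu_comp2; last exact: mu_addP.
  by apply: mu_comp1; [exact: mu_addP|exact: mu_triP].
exact: (evProj 1).
Qed.

Lemma tri_mono m n : m <= n -> tri m <= tri n.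
Proof.
move=> /subnK <-; elim: (n - m) => [|d IH] //.
by rewrite addSn triS; apply: leq_trans IH _; lia.
Qed.

(* The antidiagonal of [z = pairn a b] is the least [s] with [z < tri s.+1]. *)
Definition mu_diag :=
  MMin (MComp mu_rsub [:: MComp mu_tri [:: MComp MSucc [:: MProj 0]];
                          MComp MSucc [:: MProj 1]]).
Lemma mu_diagP a b : mu_eval mu_diag [:: pairn a b] (a + b).
Proof.
have E m : mu_eval (MComp mu_rsub [:: MComp mu_tri [:: MComp MSucc [:: MProj 0]];
    MComp MSucc [:: MProj 1]]) [:: m; pairn a b] ((pairn a b).+1 - tri m.+1).
  apply: mu_comp2; last exact: mu_rsubP.
    apply: mu_comp1; last exact: mu_triP.
    by apply: mu_comp1; [exact: (evProj 0)|exact: evSucc].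
  by apply: mu_comp1; [exact: (evProj 1)|exact: evSucc].
apply: evMin => [|m lt_m].
  by have := E (a + b); rewrite triS pairnE (_ : _ - _ = 0) //; lia.
exists ((pairn a b).+1 - tri m.+1); split => //.
by have := tri_mono lt_m; rewrite pairnE; lia.
Qed.

Definition mu_snd := MComp mu_rsub [:: MComp mu_tri [:: mu_diag]; MProj 0].
Lemma mu_sndP a b : mu_eval mu_snd [:: pairn a b] b.
Proof.
apply: mu_comp2 (_ : mu_eval _ [:: tri (a + b); pairn a b] _).
- by apply: mu_comp1; [exact: mu_diagP|exact: mu_triP].
- exact: (evProj 0).
by rewrite -[X in mu_eval _ _ X](addKn (tri (a + b))); exact: mu_rsubP.
Qed.

Definition mu_fst := MComp mu_rsub [:: mu_snd; mu_diag].
Lemma mu_fstP a b : mu_eval mu_fst [:: pairn a b] a.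
Proof.
apply: mu_comp2; [exact: mu_sndP|exact: mu_diagP|].
by rewrite -[X in mu_eval _ _ X](addnK b a); exact: mu_rsubP.
Qed.

(** * Encoded types and the closure properties of computable maps between them *)

Class Enc T := enc : T -> nat.
#[export] Instance enc_nat : Enc nat | 0 := id.
#[export] Instance enc_bool : Enc bool | 0 := nat_of_bool.
#[export] Instance enc_prod A B `{Enc A} `{Enc B} : Enc (A * B) | 1 :=
  fun p => pairn (enc p.1) (enc p.2).
#[export] Instance enc_seq A `{Enc A} : Enc (seq A) | 1 :=
  fun l => code_seq (map enc l).
Definition enc_fin (X : finType) : Enc X := @code_letter X.
#[export] Existing Instance enc_fin | 100.

(** Nothing is asked of [e] outside the codes of elements of [A], where it may diverge. *)
Definition Comp A B `{Enc A} `{Enc B} (f : A -> B) :=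
  exists e, forall a, mu_eval e [:: enc a] (enc (f a)).

Section Comp.
Context {A B C D S : Type} {eA : Enc A} {eB : Enc B} {eC : Enc C} {eD : Enc D} {eS : Enc S}.
Implicit Types (f g : A -> B) (n : A -> nat).

Lemma Comp_ext f g : Comp f -> f =1 g -> Comp g.
Proof. by case=> e He fg; exists e => a; rewrite -fg. Qed.

Lemma Comp_id : Comp (fun a : A => a).
Proof. by exists (MProj 0) => a; exact: (evProj 0). Qed.

Lemma Comp_const (b : B) : Comp (fun _ : A => b).
Proof.
suff [e He]: exists e, forall xs, mu_eval e xs (@enc B eB b) by exists e => a.
move: (@enc B eB b) => v; elim: v => [|m [e He]]; first by exists MZero => xs; exact: evZero.
by exists (MComp MSucc [:: e]) => xs; apply: mu_comp1; [exact: He|exact: evSucc].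
Qed.

Lemma Comp_comp (h : B -> C) f : Comp h -> Comp f -> Comp (fun a => h (f a)).
Proof. by case=> e1 H1 [e2 H2]; exists (MComp e1 [:: e2]) => a; apply: mu_comp1. Qed.

Lemma Comp_pair f (g : A -> C) : Comp f -> Comp g -> Comp (fun a => (f a, g a)).
Proof.
case=> e1 H1 [e2 H2]; exists (MComp mu_pair [:: e1; e2]) => a.
by apply: mu_comp2; [exact: H1|exact: H2|exact: mu_pairP].
Qed.

Lemma Comp_fst (f : A -> B * C) : Comp f -> Comp (fun a => (f a).1).
Proof. by case=> e H; exists (MComp mu_fst [:: e]) => a; apply: mu_comp1 (H a) (mu_fstP _ _). Qed.

Lemma Comp_snd (f : A -> B * C) : Comp f -> Comp (fun a => (f a).2).
Proof. by case=> e H; exists (MComp mu_snd [:: e]) => a; apply: mu_comp1 (H a) (mu_sndP _ _). Qed.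

Lemma Comp_succ n : Comp n -> Comp (fun a => (n a).+1).
Proof. by case=> e H; exists (MComp MSucc [:: e]) => a; apply: mu_comp1 (H a) (evSucc _). Qed.

Lemma Comp_rec n (s0 : A -> S) (h : A * (nat * S) -> S) :
  Comp n -> Comp s0 -> Comp h ->
  Comp (fun a => nat_rect (fun=> S) (s0 a) (fun m s => h (a, (m, s))) (n a)).
Proof.
case=> e1 H1 [e2 H2] [e3 H3].
exists (MComp (MPrec e2 (MComp e3 [:: MComp mu_pair
  [:: MProj 2; MComp mu_pair [:: MProj 0; MProj 1]]])) [:: e1; MProj 0]) => a.
apply: (mu_comp2 (H1 a) (evProj 0 _)); elim: (n a) => [|m IH]; first exact/evPrec0/H2.
apply: (evPrecS IH); apply: mu_comp1 (H3 _).
apply: mu_comp2 (mu_pairP _ _); first exact: (evProj 2).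
by apply: mu_comp2 (mu_pairP _ _); [exact: (evProj 0)|exact: (evProj 1)].
Qed.

End Comp.

Section Comp2.
Context {A B C D S : Type} {eA : Enc A} {eB : Enc B} {eC : Enc C} {eD : Enc D} {eS : Enc S}.

Lemma Comp_iter (n : A -> nat) (s0 : A -> S) (h : A * S -> S) :
  Comp n -> Comp s0 -> Comp h ->
  Comp (fun a => iter (n a) (fun s => h (a, s)) (s0 a)).
Proof.
move=> Cn Cs Ch.
have Ch' : Comp (fun p : A * (nat * S) => h (p.1, p.2.2)).
  apply: Comp_comp Ch _; apply: Comp_pair; first exact/Comp_fst/Comp_id.
  exact/Comp_snd/Comp_snd/Comp_id.
apply: Comp_ext (Comp_rec Cn Cs Ch') _ => a.
by elim: (n a) => //= m ->.
Qed.

Lemma Comp_natcase (n : A -> nat) (f : A -> B) (g : A * nat -> B) :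
  Comp n -> Comp f -> Comp g ->
  Comp (fun a => if n a is m.+1 then g (a, m) else f a).
Proof.
move=> Cn Cf Cg.
have Cg' : Comp (fun p : A * (nat * B) => g (p.1, p.2.1)).
  apply: Comp_comp Cg _; apply: Comp_pair; first exact/Comp_fst/Comp_id.
  exact/Comp_fst/Comp_snd/Comp_id.
by apply: Comp_ext (Comp_rec Cn Cf Cg') _ => a; case: (n a).
Qed.

Lemma Comp_if (c : A -> bool) (f g : A -> B) :
  Comp c -> Comp f -> Comp g -> Comp (fun a => if c a then f a else g a).
Proof.
move=> [e He] Cf Cg.
have Cc : Comp (fun a => nat_of_bool (c a)) by exists e.
have Cf' : Comp (fun p : A * nat => f p.1) by apply: Comp_comp Cf (Comp_fst Comp_id).
by apply: Comp_ext (Comp_natcase Cc Cg Cf') _ => a; case: (c a).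
Qed.

Lemma Comp_seqcase (l : A -> seq C) (f : A -> B) (g : A * (C * seq C) -> B) :
  Comp l -> Comp f -> Comp g ->
  Comp (fun a => if l a is x :: r then g (a, (x, r)) else f a).
Proof.
move=> [el Hl] [ef Hf] [eg Hg].
(* The recursion runs on the flag [l a != [::]], so that [eg] is only evaluated on codes. *)
exists (MComp (MPrec ef (MComp eg [:: MComp mu_pair
   [:: MProj 2; MComp mu_pred [:: MComp el [:: MProj 2]]]]))
  [:: MComp (MPrec MZero (MComp MSucc [:: MZero])) [:: el]; MProj 0]) => a.
have Hsg m : mu_eval (MPrec MZero (MComp MSucc [:: MZero])) [:: m] (m != 0).
  elim: m => [|m IH]; first exact/evPrec0/evZero.
  by apply: (evPrecS IH); exact: mu_comp1 (evZero _) (evSucc [:: 0]).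
apply: mu_comp2 (mu_comp1 (Hl a) (Hsg _)) (evProj 0 _) _.
case E: (l a) => [|x r] /=; first exact/evPrec0/Hf.
apply: (evPrecS (evPrec0 _ (Hf a))); apply: mu_comp1 (Hg (a, (x, r))).
apply: mu_comp2 (mu_pairP _ _); first exact: (evProj 2).
have := Hl a; rewrite E => Hla.
exact: mu_comp1 (mu_comp1 (evProj 2 [:: _; _; enc a]) Hla) (mu_predP _).
Qed.

End Comp2.

Section Comp3.
Context {A B C D S : Type} {eA : Enc A} {eB : Enc B} {eC : Enc C} {eD : Enc D} {eS : Enc S}.

Lemma Comp_nz (n : A -> nat) : Comp n -> Comp (fun a => n a != 0).
Proof.
move=> Cn; have C1 := Comp_natcase Cn (Comp_const false) (Comp_const true).
by apply: (Comp_ext (C1 _)) => a; case: (n a).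
Qed.

Lemma Comp_cons (f : A -> C) (l : A -> seq C) :
  Comp f -> Comp l -> Comp (fun a => f a :: l a).
Proof.
move=> Cf Cl; have [e He] := Comp_pair Cf Cl.
by exists (MComp MSucc [:: e]) => a; apply: mu_comp1 (He a) (evSucc _).
Qed.

End Comp3.

Section Comp4.
Context {A B C D S : Type} {eA : Enc A} {eB : Enc B} {eC : Enc C} {eD : Enc D} {eS : Enc S}.

Lemma size_enc_seq (l : seq C) : size l <= (enc l : nat).
Proof.
elim: l => //= x l IH; rewrite /enc /enc_seq /= ltnS pairnE.
exact: leq_trans IH (leq_addl _ _).
Qed.

Lemma Comp_foldl (l : A -> seq C) (s0 : A -> S) (h : A * (S * C) -> S) :
  Comp l -> Comp s0 -> Comp h ->
  Comp (fun a => foldl (fun s c => h (a, (s, c))) (s0 a) (l a)).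
Proof.
move=> Cl Cs Ch.
have Cn : Comp (fun a => enc (l a) : nat) by case: Cl => e He; exists e.
pose step (p : A * (S * seq C)) : S * seq C :=
  if p.2.2 is x :: r then (h (p.1, (p.2.1, x)), r) else p.2.
have Cstep : Comp step.
  have C1 : Comp (fun q : (A * (S * seq C)) * (C * seq C) => (h (q.1.1, (q.1.2.1, q.2.1)), q.2.2)).
    apply: Comp_pair; last by do 2!apply: Comp_snd; exact: Comp_id.
    apply: (Comp_comp Ch); apply: Comp_pair; first by do 2!apply: Comp_fst; exact: Comp_id.
    apply: Comp_pair; first by apply: Comp_fst; apply: Comp_snd; apply: Comp_fst; exact: Comp_id.
    by apply: Comp_fst; apply: Comp_snd; exact: Comp_id.
  by apply: (Comp_seqcase _ _ C1); do ?apply: Comp_snd; exact: Comp_id.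
have C1 := Comp_fst (Comp_iter Cn (Comp_pair Cs Cl) Cstep).
apply: Comp_ext C1 _ => a.
have := size_enc_seq (l a); set N := (enc (l a) : nat).
elim: (N) (s0 a) (l a) => [|m IH] s r; first by case: r.
by case: r => [|x r] szr; rewrite iterSr /=; [rewrite (IH s [::])|rewrite IH].
Qed.

End Comp4.

Section Comp5.
Context {A B C D S : Type} {eA : Enc A} {eB : Enc B} {eC : Enc C} {eD : Enc D} {eS : Enc S}.

Lemma Comp_catrev (l r : A -> seq C) :
  Comp l -> Comp r -> Comp (fun a => catrev (l a) (r a)).
Proof.
move=> Cl Cr.
have Ch : Comp (fun p : A * (seq C * C) => p.2.2 :: p.2.1).
  by apply: Comp_cons; [do 2!apply: Comp_snd|apply: Comp_fst; apply: Comp_snd]; exact: Comp_id.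
apply: Comp_ext (Comp_foldl Cl Cr Ch) _ => a.
by elim: (l a) (r a) => //= x s IH acc; rewrite IH.
Qed.

Lemma Comp_rev (l : A -> seq C) : Comp l -> Comp (fun a => rev (l a)).
Proof. by move=> Cl; exact: Comp_catrev Cl (Comp_const [::]). Qed.

Lemma Comp_nth (d : B) (lk : seq B) (n : A -> nat) :
  Comp n -> Comp (fun a => nth d lk (n a)).
Proof.
suff C1 : @Comp _ _ enc_nat eB (nth d lk) by exact: Comp_comp.
elim: lk => [|v lk IH]; first by apply: Comp_ext (Comp_const d) _ => n'; rewrite nth_nil.
have C1 : Comp (fun p : nat * nat => nth d lk p.2) by exact: (Comp_comp IH (Comp_snd Comp_id)).
by apply: Comp_ext (Comp_natcase Comp_id (Comp_const v) C1) _; case.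
Qed.

End Comp5.

Section Comp6.
Context {A B C D S : Type} {eA : Enc A} {eB : Enc B} {eC : Enc C} {eD : Enc D} {eS : Enc S}.

(** A function on a finite type is a finite table, hence computable however it was defined. *)
Lemma Comp_fin (X : finType) (f : X -> B) (g : A -> X) :
  @Comp _ _ eA (@enc_fin X) g -> Comp (fun a => f (g a)).
Proof.
suff Cf : @Comp _ _ (@enc_fin X) eB f by exact: Comp_comp.
have [e He] := Comp_nth 0 [seq eB (f x) | x <- enum X] (Comp_id (A := nat)).
exists e => x; have := He (enc_fin x).
rewrite /enc_fin /code_letter (nth_map x) ?nth_enum_rank //.
by rewrite -cardE; exact: ltn_ord.
Qed.

Lemma Comp_leq (m n : A -> nat) : Comp m -> Comp n -> Comp (fun a => m a <= n a).
Proof.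
move=> Cm [en Hn].
have Cs : Comp (fun a => m a - n a).
  case: Cm => em Hm; exists (MComp mu_rsub [:: en; em]) => a.
  by apply: mu_comp2 (Hn a) (Hm a) (mu_rsubP _ _).
have C1 := Comp_natcase Cs (Comp_const true) (Comp_const false).
by apply: (Comp_ext (C1 _)) => a; rewrite -subn_eq0; case: (_ - _).
Qed.

End Comp6.

(** Allows finite data to be treated as a constant: the program is a chain of tests along [enum X].
    If [X] is empty then so is [A], and any program will do. *)
Lemma Comp_case A B (eA : Enc A) (eB : Enc B) (X : finType) (g : A -> X) (F : X -> A -> B) :
  @Comp _ _ eA (@enc_fin X) g -> (forall x, Comp (F x)) -> Comp (fun a => F (g a) a).
Proof.
move=> Cg CF; case: (pickP (@predT X)) => [x0 _|no]; last first.
  by exists MZero => a; have := no (g a).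
suff [h Ch Eh] : exists2 h, @Comp _ _ eA eB h & forall a, g a \in enum X -> h a = F (g a) a.
  by apply: Comp_ext Ch _ => a; apply: Eh; rewrite mem_enum.
elim: (enum X) => [|x l [h Ch Eh]]; first by exists (F x0) => //; exact: CF.
exists (fun a => if g a == x then F x a else h a).
  by apply: Comp_if => //; exact: (Comp_fin (fun y => y == x)).
by move=> a; rewrite inE; case: eqP => [-> //|_] /Eh.
Qed.

(** * One-counter automata *)

Fixpoint kount (p : nat -> bool) (n : nat) : nat :=
  if n is n'.+1 then kount p n' + p n' else 0.

Lemma kount_mono p m n : m <= n -> kount p m <= kount p n.
Proof. by move=> /subnK <-; elim: (n - m) => [|d IH] //; rewrite addSn /=; lia. Qed.

Lemma kount_inj (p : nat -> bool) m n : p m -> p n -> kount p m = kount p n -> m = n.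
Proof.
move=> pm pn E; case: (ltngtP m n) => // lt.
  by have := kount_mono p lt; rewrite /= pm E; lia.
by have := kount_mono p lt; rewrite /= pn E; lia.
Qed.

(** With [kount_inj]: the times at which [p] holds are numbered by their rank [kount p], without
    gaps. *)
Lemma kount_pos (p : nat -> bool) : (forall N, exists n, N <= kount p n) ->
  forall m, exists n, p n /\ kount p n = m.
Proof.
move=> U m; have [n] := U m.+1; elim: n => // n IH /= le.
case: (leqP m.+1 (kount p n)) => [/IH //|lt].
by exists n; case: (p n) le => /= le; [split=> //; lia|lia].
Qed.

Lemma kount_unbounded (p : nat -> bool) : (forall N, exists n, N <= n /\ p n) ->
  forall N, exists n, N <= kount p n.
Proof.
move=> U; elim=> [|N [n le]]; first by exists 0.
have [m [le_m pm]] := U n; exists m.+1; rewrite /= pm.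
by have := kount_mono p le_m; lia.
Qed.

Definition recurs (p : nat -> bool) := forall N, exists n, N <= n /\ p n.

(** A set of initial states makes unions immediate; [rca_of_oca] adds a single initial state at the
    end. Letters range over any type, so that events and annotated letters can be read too. *)
Record oca (V : Type) := OCA {
  ost : finType;
  oini : ost -> Prop;
  odel : ost -> V -> bool -> ost -> cdir -> Prop;
  ofin : pred ost }.

Section OCA.
Variable V : Type.
Implicit Types (A B : oca V) (v : nat -> V).

Definition ostep A a (q : ost A) (c : nat) (q' : ost A) (c' : nat) :=
  exists d, odel q a (c != 0) q' d /\ c' = cupd c d.

Definition oacc A v := exists (rq : nat -> ost A) (rc : nat -> nat),
  [/\ oini (rq 0), rc 0 = 0,
      forall n, ostep (v n) (rq n) (rc n) (rq n.+1) (rc n.+1)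
    & recurs (fun n => ofin (rq n))].

Lemma oacc_ext A v v' : v =1 v' -> oacc A v -> oacc A v'.
Proof. by move=> E [rq [rc [H1 H2 H3 H4]]]; exists rq, rc; split=> // n; rewrite -E. Qed.

Definition oreach A v n (q : ost A) (c : nat) :=
  exists (rq : nat -> ost A) (rc : nat -> nat),
  [/\ oini (rq 0), rc 0 = 0, rq n = q, rc n = c
    & forall m, m < n -> ostep (v m) (rq m) (rc m) (rq m.+1) (rc m.+1)].

Lemma oreach0 A v (q : ost A) : oini q -> oreach v 0 q 0.
Proof. by exists (fun=> q), (fun=> 0). Qed.

Lemma oreachS A v n (q q' : ost A) c c' :
  oreach v n q c -> ostep (v n) q c q' c' -> oreach v n.+1 q' c'.
Proof.
move=> [rq [rc [H1 H2 H3 H4 H5]]] st.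
exists (fun m => if m <= n then rq m else q'), (fun m => if m <= n then rc m else c').
rewrite ltnn; split=> // m; rewrite ltnS => le; rewrite le.
case: (ltnP m n) => lt; first exact: H5.
by rewrite (_ : m = n) ?H3 ?H4 //; lia.
Qed.

Lemma oreach_acc A v n (q : ost A) c : oreach v n q c -> ofin q ->
  (forall m, n <= m -> ostep (v m) q c q c) -> oacc A v.
Proof.
move=> [rq [rc [H1 H2 H3 H4 H5]]] fq st.
exists (fun m => if m <= n then rq m else q), (fun m => if m <= n then rc m else c).
split=> [||m|N] //; last first.
  exists (N + n).+1; split; first by lia.
  by rewrite ifF //; lia.
case: (ltngtP m n) => [lt|lt|->].
- exact: H5.
- exact/st/ltnW.
by rewrite H3 H4; exact: st.
Qed.

Definition ounion A B : oca V := @OCA V (ost A + ost B)%type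
  (fun q => match q with inl q => oini q | inr q => oini q end)
  (fun q a b q' d => match q, q' with
     | inl q, inl q' => odel q a b q' d
     | inr q, inr q' => odel q a b q' d
     | _, _ => False end)
  (fun q => match q with inl q => ofin q | inr q => ofin q end).

Lemma ounionP A B v : oacc (ounion A B) v <-> oacc A v \/ oacc B v.
Proof.
split.
- move=> [rq [rc [H1 H2 H3 H4]]]; case E0: (rq 0) H1 => [q0|q0] /= H1; [left|right].
  + have E n : exists q, rq n = inl q.
      elim: n => [|n [q Eq]]; first by exists q0.
      by have [d []] := H3 n; rewrite Eq; case: (rq n.+1) => // q' _ _; exists q'.
    have [rq' Hrq'] := choice E.
    exists rq', rc; split=> //.
    * by move: (Hrq' 0); rewrite E0 => -[<-].
    * by move=> n; have := H3 n; rewrite /ostep !Hrq'.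
    * by move=> N; have [n] := H4 N; rewrite Hrq'; exists n.
  + have E n : exists q, rq n = inr q.
      elim: n => [|n [q Eq]]; first by exists q0.
      by have [d []] := H3 n; rewrite Eq; case: (rq n.+1) => // q' _ _; exists q'.
    have [rq' Hrq'] := choice E.
    exists rq', rc; split=> //.
    * by move: (Hrq' 0); rewrite E0 => -[<-].
    * by move=> n; have := H3 n; rewrite /ostep !Hrq'.
    * by move=> N; have [n] := H4 N; rewrite Hrq'; exists n.
- by case=> -[rq [rc [H1 H2 H3 H4]]];
    [exists (fun n => inl (rq n)), rc|exists (fun n => inr (rq n)), rc].
Qed.

End OCA.

(** * Padded inputs, inputs annotated by a finite transducer, inputs grouped into rounds *)

Section Skip.
Variable V : Type.
Implicit Types (A : oca V) (v : nat -> V).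

Definition ocomap (W : Type) (f : W -> V) A : oca W :=
  @OCA W (ost A) (@oini _ A) (fun q a => odel q (f a)) (@ofin _ A).

Lemma ocomapP (W : Type) (f : W -> V) A w : oacc (ocomap f A) w <-> oacc A (fun n => f (w n)).
Proof. by []. Qed.

Definition oskip A : oca (option V) := @OCA (option V) (ost A) (@oini _ A)
  (fun q a b q' d => if a is Some x then odel q x b q' d else q' = q /\ d = CStay)
  (@ofin _ A).

(** A run on [w] stands still on [None], so its configuration depends only on the number of letters
    already read; the second hypothesis ensures that infinitely many are read. *)
Lemma oskipP A v (w : nat -> option V) :
  (forall i x, w i = Some x -> x = v (kount (fun i => isSome (w i)) i)) ->
  (forall N, exists n, N <= kount (fun i => isSome (w i)) n) ->
  oacc (oskip A) w <-> oacc A v.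
Proof.
set p := fun i => isSome (w i); set k := kount p => Ew U.
split=> -[rq [rc [H1 H2 H3 H4]]]; last first.
  exists (fun i => rq (k i)), (fun i => rc (k i)); split=> // [i|N].
    rewrite /ostep /=; case E: (w i) => [x|]; last by exists CStay; rewrite /k /= /p E addn0.
    by rewrite (Ew _ _ E) /k /= /p E addn1; exact: H3.
  have [n [le fn]] := H4 (k N); have [i [pi Ei]] := kount_pos U n.
  exists (maxn i N); split; first exact: leq_maxr.
  rewrite (_ : k (maxn i N) = n) //.
  case: (leqP i N) => // le'; apply/eqP; rewrite eqn_leq le -Ei; exact: kount_mono.
have [pos Hpos] := choice (kount_pos U).
have idle i j : k i = k j -> rq i = rq j /\ rc i = rc j.
  wlog le : i j / i <= j => [W|].
    by case: (leqP i j) => [|/ltnW] le E; [apply: W|have [] := W j i le (esym E)].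
  elim: j le => [|j IH] le E; first by have -> : i = 0 by lia.
  case: (ltngtP i j.+1) le => // [lt _|-> //].
  have le1 := kount_mono p (lt : i <= j).
  have pj : p j = false by move: E; rewrite /k /=; case: (p j) => //; lia.
  have [|-> ->] := IH lt; first by move: E; rewrite /k /= pj addn0.
  have [d] := H3 j; move: pj; rewrite /p; case: (w j) => //= _ [[-> ->] ->].
  by [].
have kpos n : k (pos n) = n by case: (Hpos n).
have kposS n : k (pos n).+1 = n.+1 by case: (Hpos n); rewrite /k /= => -> ->; rewrite addn1.
exists (fun n => rq (pos n)), (fun n => rc (pos n)); split.
- by have [|-> _] := idle (pos 0) 0; rewrite ?kpos.
- by have [|_ ->] := idle (pos 0) 0; rewrite ?kpos.
- move=> n; have [|<- <-] := idle (pos n).+1 (pos n.+1); first by rewrite kpos kposS.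
  have := H3 (pos n); have [] := Hpos n; rewrite /p /ostep /=.
  case E: (w (pos n)) => [x|] // _ En; by rewrite (Ew _ _ E) kpos.
- move=> N; have [n [le fn]] := H4 (pos N); exists (k n); split.
    by rewrite -[N]kpos; exact: kount_mono.
  by have [|-> _] := idle (pos (k n)) n; rewrite ?kpos.
Qed.

End Skip.

Section Transducer.
Variables (V : Type) (T : finType) (t0 : T) (ts : T -> V -> T).

Fixpoint ttrace (v : nat -> V) (n : nat) : T :=
  if n is n'.+1 then ts (ttrace v n') (v n') else t0.

Definition otrans (A : oca (T * V)) : oca V := @OCA V (T * ost A)%type
  (fun q => q.1 = t0 /\ oini q.2)
  (fun q a b q' d => q'.1 = ts q.1 a /\ odel q.2 (q.1, a) b q'.2 d)
  (fun q => ofin q.2).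

Lemma otransP (A : oca (T * V)) v :
  oacc (otrans A) v <-> oacc A (fun n => (ttrace v n, v n)).
Proof.
split=> -[rq [rc [H1 H2 H3 H4]]]; last first.
  exists (fun n => (ttrace v n, rq n)), rc; split=> // n.
  by have [d [Hd ->]] := H3 n; exists d.
have E n : (rq n).1 = ttrace v n.
  by elim: n => [|n IH] /=; [case: H1|have [d [[-> _] _]] := H3 n; rewrite IH].
exists (fun n => (rq n).2), rc; split=> //; first by case: H1.
by move=> n; have [d [[_ Hd] ->]] := H3 n; exists d; rewrite -E.
Qed.
End Transducer.

Section Rounds.
Variables (Y : finType) (y0 : Y).

(** The transducer remembers the parity and the previous letter, so a whole round is read at its
    second letter; [y0] fills the memory before the first one. *)
Definition orounds (A : oca (Y * Y)) : oca Y :=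
  @otrans Y (bool * Y)%type (false, y0) (fun t y => (~~ t.1, y))
    (ocomap (fun w => if w.1.1 then Some (w.1.2, w.2) else None) (oskip A)).

Lemma oroundsP (A : oca (Y * Y)) (y : nat -> Y) :
  oacc (orounds A) y <-> oacc A (fun n => (y n.*2, y n.*2.+1)).
Proof.
rewrite otransP ocomapP.
have Et n : ttrace (false, y0) (fun t y => (~~ t.1, y)) y n = (odd n, if n is m.+1 then y m else y0).
  by elim: n => //= n ->; case: n.
have Ek n : kount (fun i => isSome (if odd i then Some (if i is m.+1 then y m else y0, y i) else None)) n = n./2.
  by elim: n => //= n ->; rewrite uphalf_half; case: (odd n) => /=; lia.
rewrite -(@oskipP _ A (fun n => (y n.*2, y n.*2.+1)) (fun i => if odd i then Some (if i is m.+1 then y m else y0, y i) else None)).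
- by split; apply: oacc_ext => n; rewrite Et.
- move=> i x; case Oi: (odd i) => // -[<-]; rewrite Ek.
  case: i Oi => //= i /negbTE Oi; rewrite uphalf_half Oi /=.
  by have := odd_double_half i; rewrite Oi /= add0n => ->.
- by move=> N; exists N.*2; rewrite Ek doubleK.
Qed.
End Rounds.

Section ToRBCL.
Variable (X : finType) (A : oca X).

Definition rca_of_oca : rt_counter_aut X 1 := @RTCA X 1 (option (ost A))
  (fun q a i q' j => exists p p',
     [/\ q = Some p \/ q = None /\ oini p, q' = Some p' & odel p a (i ord0) p' (j ord0)])
  None [set q | if q is Some p then ofin p else false].

Lemma rca_of_ocaP s : rca_accepts rca_of_oca s <-> oacc A s.
Proof.
split.
- move=> [rq [rc [H1 [H2 [H3 H4]]]]].
  have [p0 [p1 [H5 H6 H7]]]: exists p0 p1, [/\ oini p0, rq 1 = Some p1 &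
      ostep (s 0) p0 0 p1 (rc 1 ord0)].
    have [i [j [[p0 [p1 [Hq Hq' Hd]]] Hc]]] := H3 0.
    exists p0, p1; split=> //; first by case: Hq => [|[]//]; rewrite H1.
    have [Ei ->] := Hc ord0; rewrite H2; exists (j ord0); split=> //.
    by move: Hd; rewrite Ei H2.
  exists (fun n => if rq n is Some p then p else p0), (fun n => rc n ord0).
  split=> [||n|N] //; first by rewrite H1.
  + case: n => [|n]; first by rewrite H1 H6 H2.
    have [i [j [[p [p' [Hq Hq' Hd]]] Hc]]] := H3 n.+1.
    have [_ [_ [[_ [p'' [_ Hq'' _]]] _]]] := H3 n.
    case: Hq => [Hq|[Hq _]]; last by move: Hq''; rewrite Hq.
    rewrite Hq Hq'; have [Ei ->] := Hc ord0; exists (j ord0).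
    by rewrite -Ei.
  + have [n [le]] := H4 N; rewrite inE; exists n; split=> //.
    by move: b; case: (rq n).
- move=> [rq [rc [H1 H2 H3 H4]]].
  exists (fun n => if n is m.+1 then Some (rq n) else None), (fun n _ => rc n).
  split=> //; split=> [m|]; first by rewrite H2.
  split=> [n|N]; last first.
    by have [n [le fn]] := H4 N.+1; exists n; case: n le fn => // n le fn; rewrite inE; split=> //; lia.
  have [d [Hd Ec]] := H3 n; exists [ffun=> rc n != 0], [ffun=> d]; split.
    exists (rq n), (rq n.+1); split=> //; last by rewrite !ffunE.
    by case: n {Hd Ec} => [|n]; [right|left].
  by move=> m; rewrite !ffunE.
Qed.

Lemma oca_rBCL L : (forall s, L s <-> oacc A s) -> rBCL 1 L.
Proof. by move=> H; exists rca_of_oca => s; rewrite H rca_of_ocaP. Qed.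
End ToRBCL.

(** * Games whose Player 2 writes the run of a counter machine *)

(** [Some b] announces the label of a node, [None] the reading of the next two letters of the
    original game. *)
Definition event := option bool.

Record machine (I : finType) := Machine {
  mQ : finType;
  mk : nat;
  mq0 : mQ;
  mnext : mQ -> {ffun 'I_mk -> bool} -> I -> mQ;
  msrc : mQ -> 'I_mk -> 'I_mk;
  mop : mQ -> 'I_mk -> cdir;
  mlab : mQ -> option event }.

Section Machine.
Variables (I : finType) (M : machine I).

Definition mconf := (mQ M * ('I_(mk M) -> nat))%type.
(** Each register is obtained from a single source of the previous configuration; a wrong content is
    thus exposed by comparing two numbers, which one counter can do. *)
Definition mstep (c : mconf) (i : I) : mconf :=
  (mnext c.1 [ffun j => c.2 j != 0] i, fun j => cupd (c.2 (msrc c.1 j)) (mop c.1 j)).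
Fixpoint mrun (z : nat -> I) (n : nat) : mconf :=
  if n is n'.+1 then mstep (mrun z n') (z n') else (mq0 M, fun=> 0).

Definition isin (q : mQ M) : bool := mlab q == Some None.
Definition incount z := kount (fun n => isin (mrun z n).1).
Definition evcount z := kount (fun n => isSome (mlab (mrun z n).1)).
End Machine.

Section Game.
Variables (X : finType) (x0 : X) (M : machine (X * X)%type).
Let Q := mQ M.
Let K := mk M.
(** [inl j] writes one unit of register [j]; [inr (x, q)] closes the configuration, plays [x] and
    announces the next state [q]. Player 1 uses the same alphabet, but only the [letter] of his
    moves matters. *)
Let Y : finType := ('I_K + X * Q)%type.
Let y0 : Y := inr (x0, mq0 M).

Definition letter (y : Y) : X := if y is inr (x, _) then x else x0.
Definition isstep (y : Y) : bool := if y is inr _ then true else false.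

(** The view of a referee: [gcnt] is what has been written of the current configuration, [gexp] what
    it should contain given the previous one as written, [gin] the number of input steps
    completed. *)
Record gst := GSt {
  gq : Q; gcnt : 'I_K -> nat; gexp : 'I_K -> nat; gin : nat }.
Definition g0 := GSt (mq0 M) (fun=> 0) (fun=> 0) 0.
Definition gpat (g : gst) : {ffun 'I_K -> bool} := [ffun j => gcnt g j != 0].
Definition gstep (g : gst) (v : Y * Y) : gst :=
  match v.2 with
  | inl j => GSt (gq g) (fun i => gcnt g i + (i == j)) (gexp g) (gin g)
  | inr (b, q') => GSt q' (fun=> 0)
      (fun j => cupd (gcnt g (msrc (gq g) j)) (mop (gq g) j)) (gin g + isin (gq g))
  end.
Fixpoint gtrace (v : nat -> Y * Y) n := if n is n'.+1 then gstep (gtrace v n') (v n') else g0.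

Lemma gtraceS v n : gtrace v n.+1 = gstep (gtrace v n) (v n). Proof. by []. Qed.

Section Stream.
Variable v : nat -> Y * Y.
Let g := gtrace v.

Definition bad_state i := exists b q', (v i).2 = inr (b, q') /\
  q' <> mnext (gq (g i)) (gpat (g i)) (letter (v i).1, b).
Definition bad_stall := exists N, forall i, N <= i -> ~~ isstep (v i).2.
Definition bad_over i := exists j, gexp (g i) j < gcnt (g i) j.
(** Missing units are only established when the configuration is closed; an excess is visible at
    once. *)
Definition bad_under i := exists j, isstep (v i).2 /\ gcnt (g i) j < gexp (g i) j.
Definition bad := bad_stall \/ exists i, bad_state i \/ bad_over i \/ bad_under i.

End Stream.

(** The part of [gst] that a finite memory can hold, enough to check the announced states. *)
Definition ctrack : finType := (Q * {ffun 'I_K -> bool})%type.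
Definition ctrack0 : ctrack := (mq0 M, [ffun=> false]).
Definition ctrack_step (t : ctrack) (v : Y * Y) : ctrack :=
  match v.2 with
  | inl j => (t.1, [ffun i => t.2 i || (i == j)])
  | inr (b, q') => (q', [ffun=> false])
  end.

Lemma ttraceE v n : ttrace ctrack0 ctrack_step v n = (gq (gtrace v n), gpat (gtrace v n)).
Proof.
elim: n => [|n IH] /=; first by congr pair; apply/ffunP => j; rewrite !ffunE.
rewrite IH /ctrack_step /gstep; case: (v n).2 => [j|[b q']] /=; congr pair; apply/ffunP => i; rewrite !ffunE //=.
by case: (i == j); rewrite ?orbT ?orbF; lia.
Qed.

(** * The automaton that exposes an error of Player 2 *)

Inductive estate := EIdle | EWin | EStall | ECount of 'I_K & 'I_K | ECmp of 'I_K.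
Definition estate_code (e : estate) : option bool + ('I_K * 'I_K + 'I_K) :=
  match e with EIdle => inl None | EWin => inl (Some true) | EStall => inl (Some false)
  | ECount j s => inr (inl (j, s)) | ECmp j => inr (inr j) end.
Definition estate_decode c : estate :=
  match c with inl None => EIdle | inl (Some true) => EWin | inl (Some false) => EStall
  | inr (inl (j, s)) => ECount j s | inr (inr j) => ECmp j end.
Lemma estate_codeK : cancel estate_code estate_decode. Proof. by case. Qed.
HB.instance Definition _ := Finite.copy estate (can_type estate_codeK).

(* To catch a wrong content of register [j], count the letters of its source in one
   configuration and compare with the letters [j] of the next one. *)
Definition edel (st : estate) (a : ctrack * (Y * Y)) (nz : bool) (st' : estate) (d : cdir) : Prop :=
  let: ((q, pat), (p, r)) := a in
  match st, st' with
  | EIdle, EIdle | EIdle, EStall | EWin, EWin => d = CStay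
  | EIdle, ECount j s => d = CStay /\ isstep r
  | EIdle, EWin => d = CStay /\
      exists b q', r = inr (b, q') /\ q' <> mnext q pat (letter p, b)
  | EStall, EStall => d = CStay /\ ~~ isstep r
  | ECount j s, ECount j' s' => [/\ j = j', s = s' &
      exists i, r = inl i /\ d = if s == i then CInc else CStay]
  | ECount j s, ECmp j' => [/\ j = j', isstep r, msrc q j = s & d = mop q j]
  | ECmp j, ECmp j' => j = j' /\
      exists i, r = inl i /\ (if j == i then nz /\ d = CDec else d = CStay)
  | ECmp j, EWin => d = CStay /\ (r = inl j /\ ~~ nz \/ isstep r /\ nz)
  | _, _ => False
  end.

(** Runs may start in [ECount] or [ECmp] because a configuration begins at time 0: the empty counter
    is right both for counting its letters and for comparing with the expected content 0. *)
Definition eaut : oca (ctrack * (Y * Y)) :=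
  @OCA (ctrack * (Y * Y)) estate (fun q => match q with EWin | EStall => False | _ => True end) edel
   (fun q => match q with EWin | EStall => true | _ => false end).

Section Err.
Variable v : nat -> Y * Y.
Let g := gtrace v.
Let w n := ((gq (g n), gpat (g n)) : ctrack, v n).

Lemma eaut_sound : oacc eaut w -> bad v.
Proof.
move=> [rq [rc [H1 H2 H3 H4]]].
(* In [ECount] the counter holds the units of the source seen so far, in [ECmp] the units of
   register [j] that are still due. *)
have inv i : (match rq i with
  | EIdle => rc i = 0 | EWin => bad v | EStall => True
  | ECount j s => rc i = gcnt (g i) s
  | ECmp j => rc i + gcnt (g i) j = gexp (g i) j end : Prop).
  elim: i => [|i IH]; first by move: H1; rewrite H2; case: (rq 0).
  have [d [Hd ->]] := H3 i; move: Hd IH; rewrite /= /edel /w.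
  have Eg : g i.+1 = gstep (g i) (v i) by [].
  move: Eg; case Evi: (v i) => [p r] Eg.
  case: (rq i) => [|||j s|j]; case: (rq i.+1) => [|||j' s'|j'] //=.
  - by move=> -> ->.
  - move=> [_ [b [q' [Er Hq]]]] _; right; exists i; left; exists b, q'.
    by rewrite Evi.
  - by move=> [-> Hr] ->; rewrite Eg /gstep /=; case: r Hr {Eg Evi} => // -[b q'].
  - by move=> [_ <- [k [Er ->]]] Hc; rewrite Eg /gstep Er /= -Hc; case: (s == k) => /=; lia.
  - by move=> [<- Hr <- ->] Hc; rewrite Eg /gstep /=; case: r Hr {Eg Evi} => // -[b q'] _ /=; rewrite Hc addn0.
  - move=> [_ [[Er nz]|[Hr nz]]] Hc; right.
      exists i.+1; right; left; exists j; rewrite -/g Eg /gstep Er /= eqxx.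
      by move: nz Hc; case: (rc i) => //= _; lia.
    exists i; right; right; exists j; rewrite Evi /= Hr; split=> //; rewrite -/g.
    by move: nz; lia.
  - move=> [<- [k [Er Hk]]] Hc; rewrite Eg /gstep Er /=; move: Hk.
    by case: (j == k) => [[nz ->]|->] /=; lia.
have [n [_]] := H4 0; case E: (rq n) => //= _; first by have := inv n; rewrite E.
left; exists n.
have S i : n <= i -> rq i = EStall.
  move=> /subnK <-; elim: (i - n) => // m IH; rewrite addSn.
  by have [d [Hd _]] := H3 (m + n); move: Hd; rewrite IH /= /edel /w; case: (v _) => p r; case: (rq _.+1).
move=> i le; have [d [Hd _]] := H3 i; move: Hd; rewrite !S ?leqW //= /edel /w.
by case: (v i) => p r [].
Qed.

Let reach := @oreach _ eaut w.

Lemma reach_idle i : reach i EIdle 0.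
Proof.
elim: i => [|i IH]; first exact: oreach0.
by apply: oreachS IH _; exists CStay; rewrite /= /w; case: (v i).
Qed.

(** Counting may begin at any closing letter and at time 0, so every configuration can be counted
    from its first letter. *)
Lemma reach_count i j s : reach i (ECount j s) (gcnt (g i) s).
Proof.
elim: i => [|i IH]; first exact: oreach0.
have Eg : g i.+1 = gstep (g i) (v i) by [].
case Ev: (v i) Eg => [p [k|[b q']]] Eg; rewrite Eg /gstep /=.
  apply: oreachS IH _; exists (if s == k then CInc else CStay).
  rewrite /= /w Ev; split; last by case: (s == k) => /=; lia.
  by split=> //; exists k.
by apply: oreachS (reach_idle i) _; exists CStay; rewrite /= /w Ev.
Qed.

(** Contents only grow within a configuration, so the hypothesis at time [i] covers the earlier
    times of the same configuration and the counter never has to fall below zero. *)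
Lemma reach_cmp i j : gcnt (g i) j <= gexp (g i) j ->
  reach i (ECmp j) (gexp (g i) j - gcnt (g i) j).
Proof.
elim: i => [|i IH]; first by move=> _; exact: oreach0.
have Eg : g i.+1 = gstep (g i) (v i) by [].
case Ev: (v i) Eg => [p [k|[b q']]] Eg; rewrite Eg /gstep /= => le.
  have le' : gcnt (g i) j <= gexp (g i) j by lia.
  apply: oreachS (IH le') _; exists (if j == k then CDec else CStay).
  rewrite /= /w Ev; move: le; split; last by move: le; case: (j == k) => /=; lia.
  split=> //; exists k; split=> //; move: le; case: (j == k) => //= le; split=> //.
  by lia.
apply: oreachS (reach_count i j (msrc (gq (g i)) j)) _.
by exists (mop (gq (g i)) j); rewrite /= /w Ev subn0.
Qed.

Lemma reach_win i c : reach i EWin c -> oacc eaut w.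
Proof.
move=> R; apply: oreach_acc R _ _ => // m _; exists CStay.
by rewrite /= /w; case: (v m).
Qed.

Lemma eaut_complete : bad v -> oacc eaut w.
Proof.
case=> [[N HN]|[i B]].
  have R : reach N.+1 EStall 0.
    by apply: oreachS (reach_idle N) _; exists CStay; rewrite /= /w; case: (v N).
  apply: (oreach_acc R) => // m lt; exists CStay; rewrite /= /w.
  by have := HN m (ltnW lt); case: (v m).
have [j0|noover] := pselect (exists i', bad_over v i'); last first.
  case: B => [[b [q' [Er Hq]]]|[Ho|[j [Hr lt]]]].
  - apply: (@reach_win i.+1 0); apply: (oreachS (reach_idle i)); exists CStay; split=> //.
    by rewrite /= /w; case: (v i) Er Hq => p r /= -> Hq; split=> //; exists b, q'.
  - by case: noover; exists i.
  - apply: (@reach_win i.+1 (gexp (g i) j - gcnt (g i) j)).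
    apply: (oreachS (reach_cmp (ltnW lt))); exists CStay; split=> //.
    rewrite /= /w; case: (v i) Hr => p r /= Hr; split=> //; right; split=> //.
    by rewrite subn_eq0 -ltnNge; exact: lt.
have /cid [n [j lt]] := j0.
(* The excess is traced back to the letter that creates it; just before that letter [reach_cmp]
   applies, with counter 0. *)
elim: n lt => [|n IH]; first by rewrite /g /=.
case: (ltnP (gexp (g n) j) (gcnt (g n) j)) => [lt _|le]; first exact: IH.
have Eg : g n.+1 = gstep (g n) (v n) by [].
rewrite -/g Eg; case Ev: (v n) => [p [k|[b q']]] //; rewrite /gstep /=.
case Ejk: (j == k) => /=; last by rewrite addn0 ltnNge le.
move=> lt.
apply: (@reach_win n.+1 0); have E0 : gexp (g n) j - gcnt (g n) j = 0.
  by apply/eqP; move: lt; rewrite addn1 ltnS.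
have := reach_cmp le; rewrite E0 => R; apply: (oreachS R); exists CStay; split=> //.
by rewrite /= /w Ev; split=> //; left; rewrite (eqP Ejk).
Qed.

End Err.

(** * Plays without error follow the run of the machine *)

Section Honest.
Variable v : nat -> Y * Y.
Hypothesis good : ~ bad v.
Let g := gtrace v.
Let stp i := isstep (v i).2.

Lemma steps_unbounded N : exists n, N <= kount stp n.
Proof.
apply: kount_unbounded => {}N; apply: contrapT => H; apply: good; left; exists N => i le.
by apply/negP => st; apply: H; exists i.
Qed.

Lemma honest_input : exists z : nat -> X * X,
  forall i, stp i -> z (kount stp i) = (letter (v i).1, letter (v i).2).
Proof.
have [pos Hpos] := choice (kount_pos steps_unbounded).
exists (fun n => (letter (v (pos n)).1, letter (v (pos n)).2)) => i st.
have [Hp1 Hp2] := Hpos (kount stp i).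
by rewrite (kount_inj Hp1 st Hp2).
Qed.

Lemma honest_cnt i : stp i -> gcnt (g i) =1 gexp (g i).
Proof.
move=> st j; case: (ltngtP (gcnt (g i) j) (gexp (g i) j)) => // lt; case: good; right; exists i.
  by right; right; exists j.
by right; left; exists j.
Qed.

Variable z : nat -> X * X.
Hypothesis zE : forall i, stp i -> z (kount stp i) = (letter (v i).1, letter (v i).2).

(** The comparison is with [gexp], since at time [i] the current configuration may be only partly
    written; at a closing letter [honest_cnt] makes both agree. *)
Lemma honest_run i :
  gq (g i) = (mrun M z (kount stp i)).1 /\ gexp (g i) =1 (mrun M z (kount stp i)).2.
Proof.
elim: i => [|i [IHq IHe]] //; have Hc := @honest_cnt i; have Hz := @zE i.
have Eg : g i.+1 = gstep (g i) (v i) by [].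
rewrite Eg /gstep /=; move: Hc Hz; rewrite /stp; case Ev: (v i) => [p [k|[b q']]] /= Hc Hz.
  by rewrite addn0.
rewrite addn1 /= {}Hz //; have {}Hc := Hc isT.
have pE : gpat (g i) = [ffun j => (mrun M z (kount stp i)).2 j != 0].
  by apply/ffunP => j; rewrite !ffunE Hc IHe.
split; last by move=> j; rewrite Hc IHe IHq.
rewrite -IHq -pE; apply: contrapT => Hq; apply: good; right; exists i; left.
by exists b, q'; rewrite Ev.
Qed.

Lemma honest_gin i : gin (g i) = incount M z (kount stp i).
Proof.
elim: i => [|i IH] //; have [Hq _] := honest_run i.
have Eg : g i.+1 = gstep (g i) (v i) by [].
rewrite Eg /gstep /=; rewrite /stp; case Ev: (v i) => [p [k|[b q']]] /=; first by rewrite addn0.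
by rewrite addn1 /= IH Hq.
Qed.

End Honest.

Variables (P : oca event) (o : oword X -> nat -> event) (L : olang X).
Hypothesis machine_spec : forall (s : oword X) z,
  (forall n, isin (mrun M z n).1 ->
     z n = (s (incount M z n).*2, s (incount M z n).*2.+1)) ->
  (forall N, exists n, N <= incount M z n) /\
  (forall n e, mlab (mrun M z n).1 = Some e -> e = o s (evcount M z n)).
Hypothesis accept_spec : forall s, oacc P (o s) <-> L s.

(** Here [z] is arbitrary: each input number is attained at most once, so a word [s] can be read off
    the input steps of [z], and [machine_spec] applies to it. *)
Lemma incount_unbounded z N : exists n, N <= incount M z n.
Proof.
have E m : exists c, forall n, isin (mrun M z n).1 -> incount M z n = m -> z n = c.
  case: (pselect (exists n, isin (mrun M z n).1 /\ incount M z n = m)) => [[n [Hn En]]|H].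
    by exists (z n) => n' Hn' En'; congr z; apply: (@kount_inj (fun n => isin (mrun M z n).1)); rewrite // [RHS]En.
  by exists (x0, x0) => n Hn En; case: H; exists n.
have [c Hc] := choice E.
pose s m := if odd m then (c m./2).2 else (c m./2).1.
have [|U _] := machine_spec (s := s) (z := z); last exact: U.
move=> n Hn; rewrite (Hc _ n Hn erefl) /s /= !odd_double /= doubleK uphalf_double.
by case: (c _).
Qed.

Definition simword (v : nat -> Y * Y) n :=
  if isstep (v n).2 then mlab (gq (gtrace v n)) else None.
Definition inround (v : nat -> Y * Y) n := isstep (v n).2 && isin (gq (gtrace v n)).

Lemma incount_le_evcount z n : incount M z n <= evcount M z n.
Proof.
elim: n => //= n IH; apply: leq_add IH _.
by rewrite /isin; case: (mlab _) => // e; case: (_ == _).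
Qed.

Lemma gin_inround v n : gin (gtrace v n) = kount (inround v) n.
Proof.
elim: n => //= n <-; rewrite /gstep /inround; case: (v n).2 => [j|[b q']] /=; by rewrite ?addn0.
Qed.

Lemma honest_inround v : ~ bad v ->
  forall m, exists i, inround v i /\ gin (gtrace v i) = m.
Proof.
move=> good m; have [z zE] := honest_input good.
have [n [Hn En]] := kount_pos (incount_unbounded z) m.
have [i [Hi Ei]] := kount_pos (steps_unbounded good) n.
have [Hq _] := honest_run good zE i; exists i; split.
  by rewrite /inround Hi Hq Ei.
by rewrite (honest_gin good zE) Ei.
Qed.

(** Erasing the silent rounds of [simword v] leaves the event stream [o s], on which [P] decides
    membership in [L]. *)
Lemma honest_acc v s : ~ bad v ->
  (forall i, inround v i -> letter (v i).1 = s (gin (gtrace v i)).*2 /\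
    letter (v i).2 = s (gin (gtrace v i)).*2.+1) ->
  oacc (oskip P) (simword v) <-> L s.
Proof.
move=> good Hs; have [z zE] := honest_input good.
have Hpos := kount_pos (steps_unbounded good).
have [n|_ Hev] := machine_spec (s := s) (z := z).
  have [i [Hi <-]] := Hpos n => Hn.
  have [Hq _] := honest_run good zE i.
  have Hin : inround v i by rewrite /inround Hi Hq Hn.
  by rewrite zE // -(honest_gin good zE); have [-> ->] := Hs i Hin.
have Ek n : kount (fun i => isSome (simword v i)) n = evcount M z (kount (fun i => isstep (v i).2) n).
  elim: n => //= n ->; have [Hq _] := honest_run good zE n.
  rewrite /simword; case Hn: (isstep _); last by rewrite !addn0.
  by rewrite addn1 /= Hq.
rewrite -accept_spec; apply: oskipP.
- move=> i x; rewrite Ek /simword; case Hn: (isstep _) => //.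
  by have [-> _] := honest_run good zE i => /Hev.
- move=> N; have [n le] := incount_unbounded z N.
  have [i [_ Ei]] := Hpos n; exists i; rewrite Ek Ei.
  exact: leq_trans le (incount_le_evcount _ _).
Qed.

Definition gameaut : oca Y :=
  orounds y0 (otrans ctrack0 ctrack_step (ounion eaut
    (ocomap (fun a : ctrack * (Y * Y) => if isstep a.2.2 then mlab a.1.1 else None) (oskip P)))).
Definition rnd (y : nat -> Y) n := (y n.*2, y n.*2.+1).

Lemma gameautP y : oacc gameaut y <-> bad (rnd y) \/ oacc (oskip P) (simword (rnd y)).
Proof.
rewrite oroundsP otransP ounionP ocomapP.
have E n : ttrace ctrack0 ctrack_step (rnd y) n = (gq (gtrace (rnd y) n), gpat (gtrace (rnd y) n)).
  exact: ttraceE.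
split=> -[H|H]; [left|right|left|right].
- by apply: eaut_sound; apply: oacc_ext H => n; rewrite E.
- by apply: oacc_ext H => n; rewrite E.
- by apply: oacc_ext (eaut_complete H) => n; rewrite E.
- by apply: oacc_ext H => n; rewrite E.
Qed.

(** * Transfer of winning strategies *)

(** Recomputes the referee's state from a history; the option holds Player 1's letter while a round
    is half played. *)
Definition tk (st : gst * option Y) (y : Y) : gst * option Y :=
  if st.2 is Some p then (gstep st.1 (p, y), None) else (st.1, Some y).
Definition trk (h : seq Y) := foldl tk (g0, None) h.

Lemma trkE y n : trk (mkseq y n.*2) = (gtrace (rnd y) n, None).
Proof. by elim: n => // n IH; rewrite doubleS !mkseqS /trk !foldl_rcons -/(trk _) IH. Qed.

Lemma trkSE y n : trk (mkseq y n.*2.+1) = (gtrace (rnd y) n, Some (y n.*2)).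
Proof. by rewrite mkseqS /trk foldl_rcons -/(trk _) trkE. Qed.

Lemma historyE (Z : Type) (s1 s2 : strategy Z) n :
  history s1 s2 n = mkseq (play s1 s2) n.
Proof. by elim: n => // n IH; rewrite mkseqS /= IH /play IH. Qed.

Lemma play_even (Z : Type) (s1 s2 : strategy Z) n :
  play s1 s2 n.*2 = s1 (mkseq (play s1 s2) n.*2).
Proof. by rewrite {1}/play odd_double historyE. Qed.

Lemma play_odd (Z : Type) (s1 s2 : strategy Z) n :
  play s1 s2 n.*2.+1 = s2 (mkseq (play s1 s2) n.*2.+1).
Proof. by rewrite -historyE {1}/play (_ : odd n.*2.+1) //= odd_double. Qed.

(* The faithful moves of Player 2 when his letters in the game on [L] are [b]. *)
Definition honest (b : nat -> X) (h : seq Y) : Y :=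
  let: (g, p) := trk h in
  if [pick j | gcnt g j < gexp g j] is Some j then inl j else
  let x := if isin (gq g) then b (gin g) else x0 in
  inr (x, mnext (gq g) (gpat g) (letter (odflt y0 p), x)).

(** Player 1 does not know in which round the next input step will be closed, so he repeats the same
    letter until it is consumed. The state [mq0 M] is a dummy. *)
Definition copying (a : nat -> X) (h : seq Y) : Y := inr (a (gin (trk h).1), mq0 M).

Lemma gtrace_ext (v v' : nat -> Y * Y) n :
  (forall i, i < n -> v i = v' i) -> gtrace v n = gtrace v' n.
Proof. by elim: n => //= n IH E; rewrite IH ?E // => i lt; apply: E; exact: ltnW. Qed.

Section P1.
Variable s1 : strategy Y.
Let y b := play s1 (honest b).
Let v b := rnd (y b).

Lemma honest_move b i :
  (v b i).2 = honest b (mkseq (y b) i.*2.+1).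
Proof. exact: play_odd. Qed.

Lemma honest_le b i j : gcnt (gtrace (v b) i) j <= gexp (gtrace (v b) i) j.
Proof.
elim: i j => [|i IH] j //; have := honest_move b i; rewrite /honest trkSE -/(v b).
rewrite gtraceS /gstep.
case: pickP => [k lt|H] -> //=.
by case: (j =P k) => [->|_]; rewrite ?addn1 ?addn0.
Qed.

Lemma honest_good b : ~ bad (v b).
Proof.
case=> [[N HN]|[i [[x [q' [Er Hq]]]|[[j lt]|[j [Hr lt]]]]]].
- pose g i := gtrace (v b) i.
  (* Without closing letters [gexp] is frozen while each round adds one unit; after one round more
     than the total expected content, some register would exceed its bound. *)
  have ge i : N <= i -> gexp (g i) = gexp (g N) /\ i <= N + \sum_j gcnt (g i) j.
    move=> /subnK <-; elim: (i - N) => [|d [IH1 IH2]]; first by rewrite add0n leq_addr.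
    have := HN (d + N) (leq_addl _ _); rewrite /g addSn gtraceS /gstep.
    case: (v b (d + N)).2 => [k _|p] //=.
    split=> //.
    rewrite big_split /= [X in _ + (_ + X)](bigD1 k) //= eqxx.
    rewrite [X in _ + (_ + (_ + X))]big1; last by move=> j /negbTE ->.
    by rewrite addn0 addn1 addnS ltnS.
  pose B := \sum_j gexp (g N) j.
  have := ge (N + B.+1) (leq_addr _ _); rewrite /g; move: (gtrace _ (N + B.+1)) (honest_le b (N + B.+1)) => h le [E].
  rewrite leq_add2l ltnNge => /negP; apply; rewrite /B -E; apply: leq_sum => k _; exact: le.
- apply: Hq; have := honest_move b i; rewrite /honest trkSE -/(v b) Er.
  by case: pickP => [//|_] [-> ->].
- by move: lt; rewrite ltnNge honest_le.
- have := honest_move b i; rewrite /honest trkSE -/(v b).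
  case: pickP => [k _ E|H _]; first by rewrite E in Hr.
  by have := H j; rewrite lt.
Qed.

Lemma honest_in b i : inround (v b) i -> letter (v b i).2 = b (gin (gtrace (v b) i)).
Proof.
rewrite /inround => /andP[Hs Hi]; have := honest_move b i; rewrite /honest trkSE -/(v b).
by case: pickP => [k _ E|_ ->]; [rewrite E in Hs|rewrite /= Hi].
Qed.

(** [honest] consults [b] only when it closes an input step, and then only at the index [gin]. *)
Lemma honest_causal b b' m n : (forall k, k < m -> b k = b' k) ->
  (forall i, i.*2.+1 < n -> inround (v b) i -> gin (gtrace (v b) i) < m) ->
  mkseq (y b) n = mkseq (y b') n.
Proof.
move=> Eb; elim: n => // n IH H.
have {}IH := IH (fun i lt => H i (ltnW lt)).
rewrite !mkseqS IH; congr rcons.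
have := odd_double_half n; move: (n./2) => k; case: (odd n); rewrite ?add0n ?add1n => E; subst n; last first.
  by rewrite [LHS]play_even [RHS]play_even -/(y b) -/(y b') IH.
have Ht : trk (mkseq (y b) k.*2.+1) = trk (mkseq (y b') k.*2.+1) by rewrite IH.
have := H k (ltnSn _).
have Hmv := honest_move b k; rewrite /inround Hmv [LHS]play_odd [RHS]play_odd.
rewrite -/(y b) -/(y b') /honest -Ht trkSE -/(v b).
case: pickP => //= _; case: ifP => //= Hi Hin.
by rewrite Eb //; exact: Hin.
Qed.

Definition answer1 b m x := exists i,
  [/\ inround (v b) i, gin (gtrace (v b) i) = m & x = letter (v b i).1].

(** The bound on [k] is strict because Player 1 writes before [b m] is disclosed in the same
    round. *)
Lemma answer1_causal b b' m x x' : (forall k, k < m -> b k = b' k) ->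
  answer1 b m x -> answer1 b' m x' -> x = x'.
Proof.
move=> Eb [i [Hi Ei ->]] [i' [Hi' Ei' ->]].
have C : mkseq (y b) i.*2.+1 = mkseq (y b') i.*2.+1.
  apply: (honest_causal Eb) => k lt Hk; rewrite -Ei.
  have lt' : k < i by lia.
  by rewrite !gin_inround; have := kount_mono (inround (v b)) lt'; rewrite /= Hk addn1.
have nthE (f : nat -> Y) k : k <= i.*2 -> f k = nth y0 (mkseq f i.*2.+1) k by move=> le; rewrite nth_mkseq.
have Eg : gtrace (v b) i = gtrace (v b') i.
  by apply: gtrace_ext => k lt; rewrite /v /rnd !(nthE (y b)) ?(nthE (y b')) ?C //; lia.
have E1 : (v b i).1 = (v b' i).1 by rewrite /v /rnd /= (nthE (y b)) // C -nthE.
have Hb' : inround (v b') i.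
  move: Hi; rewrite /inround Eg; have := honest_move b i; have := honest_move b' i.
  rewrite /honest -C trkSE -/(v b) Eg.
  by case: pickP => [k _ -> ->|_ -> ->].
rewrite E1; have -> : i = i'; last by [].
by apply: (kount_inj Hb' Hi'); rewrite -!gin_inround Ei' -Eg.
Qed.

End P1.

Section P2.
Variable s2 : strategy Y.
Let y a := play (copying a) s2.
Let v a := rnd (y a).

Lemma copying_letter a i : letter (v a i).1 = a (gin (gtrace (v a) i)).
Proof. by rewrite /v /rnd /= /y play_even /copying trkE. Qed.

Definition answer2 a m x := exists i,
  [/\ inround (v a) i, gin (gtrace (v a) i) = m & x = letter (v a i).2].

Lemma copying_causal a a' m n : (forall k, k <= m -> a k = a' k) ->
  (forall i, i.*2 < n -> gin (gtrace (v a) i) <= m) ->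
  mkseq (y a) n = mkseq (y a') n.
Proof.
move=> Ea; elim: n => // n IH H.
have {}IH := IH (fun i lt => H i (ltnW lt)).
rewrite !mkseqS IH; congr rcons.
have := odd_double_half n; move: (n./2) => k; case: (odd n); rewrite ?add0n ?add1n => E; subst n.
  by rewrite [LHS]play_odd [RHS]play_odd -/(y a) -/(y a') IH.
rewrite [LHS]play_even [RHS]play_even -/(y a) -/(y a') -IH /copying trkE.
by rewrite /= Ea //; exact: H.
Qed.

(** The bound on [k] is not strict: Player 2 has already seen [a m] when he closes the input
    step. *)
Lemma answer2_causal a a' m x x' : (forall k, k <= m -> a k = a' k) ->
  answer2 a m x -> answer2 a' m x' -> x = x'.
Proof.
move=> Ea [i [Hi Ei ->]] [i' [Hi' Ei' ->]].
have C : mkseq (y a) i.*2.+2 = mkseq (y a') i.*2.+2.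
  apply: (copying_causal Ea) => k lt; rewrite -Ei !gin_inround.
  by apply: kount_mono; lia.
have nthE (f : nat -> Y) k : k <= i.*2.+1 -> f k = nth y0 (mkseq f i.*2.+2) k by move=> le; rewrite nth_mkseq.
have Ev k : k <= i -> v a k = v a' k.
  by move=> le; rewrite /v /rnd !(nthE (y a)) ?(nthE (y a')) ?C //; lia.
have Eg : gtrace (v a) i = gtrace (v a') i by apply: gtrace_ext => k /ltnW /Ev.
have Ha' : inround (v a') i by move: Hi; rewrite /inround Eg Ev.
rewrite Ev //; have -> : i = i'; last by [].
by apply: (kount_inj Ha' Hi'); rewrite -!gin_inround Ei' -Eg.
Qed.

End P2.

Lemma game_reduction : Det (rBCL 1) -> determined L.
Proof.
move=> /(_ Y (inhabits y0) (fun y => oacc gameaut y)) [|[s1 W]|[s2 W]].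
- exact: (@oca_rBCL _ gameaut).
- left.
  have ex (bm : (nat -> X) * nat) : exists x, answer1 s1 bm.1 bm.2 x.
    have [i [Hi Ei]] := honest_inround (@honest_good s1 bm.1) bm.2.
    by eexists; exists i.
  have [a Ha] := choice ex.
  (* Letters beyond the history are replaced by [x0]; by [answer1_causal] the reply does not depend
     on them. *)
  exists (fun h => a (fun k => nth x0 h k.*2.+1, (size h)./2)) => s2.
  set s := play _ s2; pose b k := s k.*2.+1.
  have sE m : s m.*2 = a (b, m).
    rewrite /s play_even -/s size_mkseq doubleK.
    apply: (@answer1_causal s1 _ b m) (Ha (_, m)) (Ha (b, m)) => k lt.
    by rewrite /= nth_mkseq //; lia.
  have good := @honest_good s1 b.
  have [H|] := (gameautP _).1 (W (honest b)); first by case: good.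
  apply: (honest_acc good _).1 => i Hi; rewrite (honest_in Hi) sE; split=> //.
  by apply: (@answer1_causal s1 b b) (Ha (b, _)) => //; exists i.
- right.
  (* Errors are accepted by [gameaut], so a winning strategy of Player 2 never makes one. *)
  have good a : ~ bad (rnd (play (copying a) s2)).
    by move=> H; apply: (W (copying a)); apply/gameautP; left.
  have ex (am : (nat -> X) * nat) : exists x, answer2 s2 am.1 am.2 x.
    have [i [Hi Ei]] := honest_inround (@good am.1) am.2.
    by eexists; exists i.
  have [b Hb] := choice ex.
  exists (fun h => b (fun k => nth x0 h k.*2, (size h)./2)) => s1.
  set s := play s1 _; pose a k := s k.*2.
  have sE m : s m.*2.+1 = b (a, m).
    rewrite /s play_odd -/s size_mkseq /= uphalf_double.
    apply: (@answer2_causal s2 _ a m) (Hb (_, m)) (Hb (a, m)) => k lt.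
    by rewrite /= nth_mkseq //; lia.
  move=> Ls; apply: (W (copying a)); apply/gameautP; right.
  apply: (honest_acc (@good a) (s := s) _).2 Ls => i Hi.
  rewrite copying_letter sE; split=> //.
  by apply: (@answer2_causal s2 a a) (Hb (a, _)) => //; exists i.
Qed.

End Game.

(** * Choosing a branch with a counter *)

Section Pointer.
Variable lbl : nat -> nat -> bool.

(** Level [m] consists of the binary words of length [m.+1]; the empty word is not listed. *)
Definition width m := 2 ^ m.+1.

(** Level [m] lasts one event more than its number of nodes: at [j = width m] a round of the
    original game is read. *)
Fixpoint clock (i : nat) : nat * nat :=
  if i is i'.+1 then
    let: (m, j) := clock i' in if j < width m then (m, j.+1) else (m.+1, 0)
  else (0, 0).

Lemma clockS i : clock i.+1 =
  let: (m, j) := clock i in if j < width m then (m, j.+1) else (m.+1, 0).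
Proof. by []. Qed.

Definition levels (i : nat) : event :=
  let: (m, j) := clock i in if j < width m then Some (lbl m j) else None.

(* The node of the branch [t] in level [m] has index [2 r + t m], where [r] is the number of nodes
   listed after its parent in the previous level: this is what a counter can compute. *)
Fixpoint remaining (t : nat -> bool) (m : nat) : nat :=
  if m is m'.+1 then width m' - (remaining t m').*2 - t m' - 1 else 0.
Definition branch t m := (remaining t m).*2 + t m.

(** [PSkip] and [PSkip1] pass over two nodes per unit of the counter. With the counter at 0 the run
    takes the current node, or goes to [PTake] to take the next one. Afterwards the counter counts
    upwards; [PHit] is [PCount] with the record that the chosen node has label true. *)
Inductive pstate := PSkip | PSkip1 | PTake | PCount | PHit.
Definition pstate_code p : option (option bool) + unit :=
  match p with PSkip => inl None | PSkip1 => inl (Some None) | PTake => inl (Some (Some true))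
  | PCount => inl (Some (Some false)) | PHit => inr tt end.
Definition pstate_decode c : pstate :=
  match c with inl None => PSkip | inl (Some None) => PSkip1 | inl (Some (Some true)) => PTake
  | inl (Some (Some false)) => PCount | inr tt => PHit end.
Lemma pstate_codeK : cancel pstate_code pstate_decode. Proof. by case. Qed.
HB.instance Definition _ := Finite.copy pstate (can_type pstate_codeK).

Definition phit (l : bool) := if l then PHit else PCount.

Definition pdel (p : pstate) (e : event) (nz : bool) (p' : pstate) (d : cdir) : Prop :=
  match p, e with
  | PSkip, Some l => d = CStay /\
      if nz then p' = PSkip1 else p' = phit l \/ p' = PTake
  | PSkip1, Some _ => p' = PSkip /\ d = CDec
  | PTake, Some l => p' = phit l /\ d = CStay
  | (PCount | PHit), Some _ => p' = PCount /\ d = CInc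
  | (PCount | PHit), None => p' = PSkip /\ d = CStay
  | _, None => False
  end.

Definition pointer : oca event :=
  @OCA event pstate (fun p => p = PSkip) pdel (fun p => if p is PHit then true else false).

Lemma widthS m : width m.+1 = (width m).*2.
Proof. by rewrite /width expnS mul2n. Qed.

Lemma remaining_lt t m : (remaining t m).*2 < width m.
Proof.
elim: m => [|m IH] //; rewrite widthS ltn_double /=.
by move: IH; lia.
Qed.

Lemma branch_lt t m : branch t m < width m.
Proof.
rewrite /branch; have := remaining_lt t m; rewrite /width expnS mul2n ltn_double => lt.
by case: (t m) => /=; lia.
Qed.

Lemma branch_remaining t m : remaining t m.+1 = width m - 1 - branch t m.
Proof. by rewrite /= /branch; lia. Qed.

Fixpoint start m := if m is m'.+1 then (start m' + width m').+1 else 0.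

Lemma clock_start m j : j <= width m -> clock (start m + j) = (m, j).
Proof.
elim: m j => [|m IHm]; elim=> [|j IHj] // le.
- by rewrite addnS clockS IHj ?(ltnW le) // le.
- by rewrite addn0 clockS IHm // ltnn.
- by rewrite addnS clockS IHj ?(ltnW le) // le.
Qed.

Lemma clockP i : exists m j, [/\ clock i = (m, j), j <= width m & i = start m + j].
Proof.
elim: i => [|i [m [j [E le Ei]]]]; first by exists 0, 0.
case: (ltnP j (width m)) => lt.
  by exists m, j.+1; rewrite /= E lt; split=> //; rewrite addnS Ei.
exists m.+1, 0; rewrite /= E ltnNge lt /=; split=> //.
by rewrite Ei (_ : j = width m) ?addn0 //; lia.
Qed.

Lemma start_mono m n : m <= n -> start m <= start n.
Proof. by move=> /subnK <-; elim: (n - m) => [|d IH] //; rewrite addSn /=; lia. Qed.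

Lemma start_ge m : m <= start m.
Proof. by elim: m => //= m IH; lia. Qed.

Lemma pointer_complete t : (forall N, exists m, N <= m /\ lbl m (branch t m)) ->
  oacc pointer levels.
Proof.
move=> H.
(* The intended run: up to the chosen node, [ct] counts down the pairs of nodes still to be skipped;
   after it, the nodes that have followed. *)
pose st m j := if branch t m < j then phit ((j == (branch t m).+1) && lbl m (branch t m))
  else if j == (remaining t m).*2.+1 then PTake else if odd j then PSkip1 else PSkip.
pose ct m j := if branch t m < j then j - 1 - branch t m else remaining t m - j./2.
exists (fun i => st (clock i).1 (clock i).2), (fun i => ct (clock i).1 (clock i).2).
split=> // [i|N]; last first.
  have [m [le Hm]] := H N; exists (start m + (branch t m).+1); split.
    by apply: leq_trans (leq_addr _ _); apply: leq_trans (start_ge _).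
  by rewrite clock_start ?branch_lt //= /st ltnSn eqxx Hm.
have [m [j [E le _]]] := clockP i; rewrite /levels [clock i.+1]/= E.
case: (ltnP j (width m)) => lt /=; last first.
  have {lt le} -> : j = width m by lia.
  have := branch_lt t m; rewrite /st /ct => lt; rewrite lt branch_remaining.
  exists CStay; split; last by rewrite /=; lia.
  by rewrite /= /phit; case: ifP.
rewrite /ostep /st /ct ltnS; case: (ltngtP j (branch t m)) => ltj.
- case: eqP => [Ej|nEj].
    by move: ltj; rewrite /branch Ej; case: (t m) => /=; lia.
  have := odd_double_half j; case Oj: (odd j) => Ej.
    exists CDec; split; last by rewrite /=; lia.
    rewrite /= ; rewrite ifF; last by lia.
    by rewrite Oj.
  case: (j.+1 =P _) => Ej'.
    have -> : remaining t m - j./2 = 0 by lia.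
    by exists CStay; split=> /=; [split=> //; right|lia].
  have E0 : remaining t m - j./2 != 0.
    by move: ltj; rewrite /branch; case: (t m) => /=; lia.
  exists CStay; split; last by rewrite /= uphalf_half; lia.
  by rewrite E0 /= Oj.
- exists CInc; split; last by rewrite /=; lia.
  rewrite (_ : (j.+1 == _) = false) /=; last by lia.
  by rewrite /phit; case: ifP.
- rewrite -ltj eqxx; have -> : j.+1 - 1 - j = 0 by lia.
  case: (j =P _) => Ej.
    by exists CStay; split=> //=; lia.
  have tm : t m = false by move: Ej; rewrite ltj /branch; case: (t m) => //=; lia.
  have E2 : j = (remaining t m).*2 by rewrite ltj /branch tm addn0.
  rewrite {1}E2 odd_double E2 doubleK subnn; exists CStay; split=> //.
  by split=> //; left.
Qed.

Section Sound.
Variables (rq : nat -> pstate) (rc : nat -> nat).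
Hypothesis run0 : rq 0 = PSkip.
Hypothesis cnt0 : rc 0 = 0.
Hypothesis run : forall n, @ostep _ pointer (levels n) (rq n) (rc n) (rq n.+1) (rc n.+1).

Let q m j := rq (start m + j).
Let c m j := rc (start m + j).

Lemma run_entry m j : j < width m ->
  @ostep _ pointer (Some (lbl m j)) (q m j) (c m j) (q m j.+1) (c m j.+1).
Proof.
move=> lt; have := run (start m + j).
by rewrite /levels clock_start ?(ltnW lt) // lt /q /c !addnS.
Qed.

Lemma run_end m :
  @ostep _ pointer None (q m (width m)) (c m (width m)) (q m.+1 0) (c m.+1 0).
Proof.
have := run (start m + width m).
by rewrite /levels clock_start // ltnn /q /c !addn0.
Qed.

Definition counting m J j :=
  [/\ J < j, c m j = j - 1 - J & q m j = phit ((j == J.+1) && lbl m J)].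

Lemma counting_step m J j : j < width m -> counting m J j -> counting m J j.+1.
Proof.
move=> lt [H1 H2 H3]; have [d []] := run_entry lt; rewrite H2 H3 /= /phit => Hd Ec.
have [Eq Ed] : q m j.+1 = PCount /\ d = CInc by move: Hd; case: ifP.
rewrite Ed /= in Ec; split; rewrite ?Ec ?Eq; [by lia|by lia|].
by rewrite (_ : (j.+1 == J.+1) = false) //; lia.
Qed.

Lemma counting_end m J j : j <= width m -> counting m J j -> counting m J (width m).
Proof.
move=> le C; suff H d : j + d <= width m -> counting m J (j + d).
  by have := H (width m - j); rewrite subnKC //; apply.
elim: d => [|d IH] lt; first by rewrite addn0.
by rewrite addnS; apply: counting_step; [|apply: IH]; lia.
Qed.

(** In the first three cases no node of the level has been taken yet. *)
Definition inv m j :=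
  [\/ [/\ q m j = PSkip, odd j = false & c m j + j./2 = c m 0],
      [/\ q m j = PSkip1, odd j, 0 < c m j & c m j + j./2 = c m 0],
      [/\ q m j = PTake, j = (c m 0).*2.+1 & c m j = 0] |
      exists b : bool, counting m ((c m 0).*2 + b) j].

Lemma inv_level m j : q m 0 = PSkip -> j <= width m -> inv m j.
Proof.
move=> E0; elim: j => [|j IH] lt; first by apply: Or41; rewrite addn0.
have [d [Hd Hc]] := run_entry lt.
case: (IH (ltnW lt)) => [[Eq Oj Ec]|[Eq Oj nz Ec]|[Eq Ej Ec]|[b C]].
- move: Hd; rewrite Eq /= => -[Ed]; move: Hc; rewrite Ed /= => Hc.
  have := odd_double_half j; rewrite Oj add0n => Ej.
  case: ifP => nz; last case.
  + by move=> Eq'; apply: Or42; rewrite Eq' Hc /= Oj uphalf_half Oj; split=> //; lia.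
  + move=> Eq'; apply: Or44; exists false; split; rewrite ?Hc ?Eq' ?addn0.
    * by lia.
    * by lia.
    * by rewrite (_ : j = (c m 0).*2) ?eqxx //; lia.
  + by move=> Eq'; apply: Or43; split=> //; lia.
- move: Hd; rewrite Eq /= => -[Eq' Ed]; move: Hc; rewrite Ed /= => Hc.
  by apply: Or41; rewrite Eq' Hc /= Oj uphalf_half Oj; split=> //; lia.
- move: Hd; rewrite Eq /= => -[Eq' Ed]; move: Hc; rewrite Ed /= => Hc.
  apply: Or44; exists true; split; rewrite ?Hc ?Eq' ?addn1 -?Ej ?eqxx //.
  by rewrite Ec; lia.
- by apply: Or44; exists b; exact: counting_step.
Qed.

Lemma level_end m : q m 0 = PSkip ->
  exists b : bool, counting m ((c m 0).*2 + b) (width m) /\ q m.+1 0 = PSkip /\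
    c m.+1 0 = width m - 1 - ((c m 0).*2 + b).
Proof.
move=> E0; have [d [Hd Hc]] := run_end m.
case: (inv_level E0 (leqnn _)) => [[Eq _ _]|[Eq _ _ _]|[Eq _ _]|[b C]].
(* A run that has not taken a node has no transition at the end of the level. *)
1-3: by move: Hd; rewrite Eq.
exists b; split=> //; move: Hd Hc; have [_ -> ->] := C.
by case: (phit _) => //= -[-> ->].
Qed.

Lemma pointer_sound : recurs (fun n => @ofin _ pointer (rq n)) ->
  exists t, forall N, exists m, N <= m /\ lbl m (branch t m).
Proof.
move=> fin.
have qS m : q m 0 = PSkip by elim: m => // m /level_end [b [_ []]].
have [t Ht] := choice (fun m => level_end (qS m)).
exists t => N.
have Er m : c m 0 = remaining t m.
  elim: m => // m IH; have [_ [_ ->]] := Ht m; rewrite IH branch_remaining //.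
have [i [le]] := fin (start N); have [m [j [_ lej Ei]]] := clockP i.
rewrite Ei -/(q m j) => Hit; exists m; split.
  rewrite leqNgt; apply/negP => lt; have := start_mono lt; rewrite /= ltnNge.
  by move/negP; apply; apply: leq_trans le _; rewrite Ei leq_add2l.
case: (inv_level (qS m) lej) => [[Eq _ _]|[Eq _ _ _]|[Eq _ _]|[b C]].
1-3: by move: Hit; rewrite Eq.
(* The bit [b] of the hit and the bit [t m] were obtained separately; the counter at the end of the
   level determines the index of the node taken, so both describe the same node. *)
have [_ E1 _] := counting_end lej C; have [[lt E2 _] _] := Ht m.
have lt' : (c m 0).*2 + b < width m by have [] := C; lia.
have Eb : (c m 0).*2 + b = branch t m by rewrite /branch -Er; lia.
by move: Hit; have [_ _ ->] := C; rewrite Eb /phit; case: ifP => // /andP[].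
Qed.

End Sound.

Lemma pointerP : oacc pointer levels <->
  exists t, forall N, exists m, N <= m /\ lbl m (branch t m).
Proof.
split=> [[rq [rc [H1 H2 H3 H4]]]|[t]]; last exact: pointer_complete.
exact: pointer_sound H1 H2 H3 H4.
Qed.
End Pointer.

(** * Counter machines for recursive transducers *)

Inductive cmd :=
  | Asg (d s : nat) (op : cdir)
  | Seq (c1 c2 : cmd)
  | While (r : nat) (c : cmd)
  | If (r : nat) (c1 c2 : cmd)
  | Emit (b : bool)
  | Input (d : nat).

Section Cmd.
Variable I : finType.
Notation N := #|I|.
Notation regs := (nat -> nat).

(** The point [None] is the test of a loop or conditional, or the point where [Input] reads. For a
    loop, leaving the body, which [nxt] also renders as [None], is thereby the return to the
    test. *)
Fixpoint ctl (c : cmd) : finType :=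
  match c with
  | Asg _ _ _ | Emit _ => unit
  | Seq c1 c2 => (ctl c1 + ctl c2)%type
  | While _ c => option (ctl c)
  | If _ c1 c2 => option (ctl c1 + ctl c2)
  | Input _ => option 'I_N
  end.

Fixpoint entry (c : cmd) : ctl c :=
  match c with
  | Asg _ _ _ | Emit _ => tt
  | Seq c1 c2 => inl (entry c1)
  | While _ _ | If _ _ _ | Input _ => None
  end.

(* After reading a letter of rank [k], [Input d] increments [d] [k] times. *)
Fixpoint nxt (c : cmd) : ctl c -> (nat -> bool) -> I -> option (ctl c) :=
  match c with
  | Asg _ _ _ | Emit _ => fun _ _ _ => None
  | Seq c1 c2 => fun q p i => match q with
      | inl q1 => Some (if nxt q1 p i is Some q1' then inl q1' else inr (entry c2))
      | inr q2 => omap inr (nxt q2 p i) end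
  | While r c => fun q p i => match q with
      | None => if p r then Some (Some (entry c)) else None
      | Some q1 => Some (nxt q1 p i) end
  | If r c1 c2 => fun q p i => match q with
      | None => Some (Some (if p r then inl (entry c1) else inr (entry c2)))
      | Some (inl q1) => omap (fun q => Some (inl q)) (nxt q1 p i)
      | Some (inr q2) => omap (fun q => Some (inr q)) (nxt q2 p i) end
  | Input d => fun q p i => match q with
      | None => Some (Some (enum_rank i))
      | Some k => if k == 0 :> nat then None else Some (insub k.-1) end
  end.

Fixpoint asg (c : cmd) : ctl c -> option (nat * nat * cdir) :=
  match c with
  | Asg d s op => fun _ => Some (d, s, op)
  | Emit _ => fun _ => None
  | Seq c1 c2 => fun q => match q with inl q1 => asg q1 | inr q2 => asg q2 end
  | While r c => fun q => match q with None => None | Some q1 => asg q1 end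
  | If r c1 c2 => fun q => match q with
      | None => None | Some (inl q1) => asg q1 | Some (inr q2) => asg q2 end
  | Input d => fun q => match q with
      | None => None
      | Some k => if k == 0 :> nat then None else Some (d, d, CInc) end
  end.

Fixpoint lab (c : cmd) : ctl c -> option event :=
  match c with
  | Asg _ _ _ => fun _ => None
  | Emit b => fun _ => Some (Some b)
  | Seq c1 c2 => fun q => match q with inl q1 => lab q1 | inr q2 => lab q2 end
  | While r c => fun q => match q with None => None | Some q1 => lab q1 end
  | If r c1 c2 => fun q => match q with
      | None => None | Some (inl q1) => lab q1 | Some (inr q2) => lab q2 end
  | Input d => fun q => match q with None => Some None | Some _ => None end
  end.

Fixpoint maxreg (c : cmd) : nat :=
  match c with
  | Asg d s _ => maxn d s
  | Seq c1 c2 => maxn (maxreg c1) (maxreg c2)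
  | While r c => maxn r (maxreg c)
  | If r c1 c2 => maxn r (maxn (maxreg c1) (maxreg c2))
  | Emit _ => 0
  | Input d => d
  end.

Lemma asg_maxreg c (q : ctl c) d s op : asg q = Some (d, s, op) -> s <= maxreg c.
Proof.
elim: c q => [d' s' op'|c1 IH1 c2 IH2|r c IH|r c1 IH1 c2 IH2|b|d'] //=.
- by move=> _ [_ <- _]; exact: leq_maxr.
- by case=> q; [move/IH1|move/IH2]; lia.
- by case=> // q /IH; lia.
- by case=> // -[] q; [move/IH1|move/IH2]; lia.
- by case=> // k; case: eqP => // _ [_ <- _].
Qed.

Lemma nxt_ext c (q : ctl c) p p' i : (forall r, r <= maxreg c -> p r = p' r) ->
  nxt q p i = nxt q p' i.
Proof.
elim: c q => [d' s' op'|c1 IH1 c2 IH2|r c IH|r c1 IH1 c2 IH2|b|d'] //=.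
- by case=> q H; rewrite ?IH1 ?IH2 // => r le; apply: H; lia.
- case=> [q|] H; first by rewrite IH // => r' le; apply: H; lia.
  by rewrite H // leq_maxl.
- case=> [[] q|] H.
  + by rewrite IH1 // => r' le; apply: H; lia.
  + by rewrite IH2 // => r' le; apply: H; lia.
  + by rewrite H // leq_maxl.
Qed.

(** The machine receives a letter at every step; this is why those given outside input steps are
    harmless. *)
Lemma nxt_indep c (q : ctl c) p i i' : lab q <> Some None -> nxt q p i = nxt q p i'.
Proof.
elim: c q => [d' s' op'|c1 IH1 c2 IH2|r c IH|r c1 IH1 c2 IH2|b|d'] //=.
- by case=> q H; [rewrite (IH1 q)|rewrite (IH2 q)].
- by case=> [q|] H //; rewrite (IH q).
- by case=> [[] q|] H //; [rewrite (IH1 q)|rewrite (IH2 q)].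
- by case.
Qed.

Definition upd (rf : regs) (a : option (nat * nat * cdir)) : regs :=
  if a is Some (d, s, op) then fun r => if r == d then cupd (rf s) op else rf r else rf.

Definition nz (rf : regs) r := rf r != 0.

Definition emitted (o : option event) (i : I) : seq (bool + I) :=
  match o with None => [::] | Some (Some b) => [:: inl b] | Some None => [:: inr i] end.

Inductive trace (c : cmd) : ctl c -> regs -> seq (bool + I) -> regs -> Prop :=
| trace_exit q rf i : nxt q (nz rf) i = None ->
    trace q rf (emitted (lab q) i) (upd rf (asg q))
| trace_step q q' rf i l rf' : nxt q (nz rf) i = Some q' ->
    trace q' (upd rf (asg q)) l rf' -> trace q rf (emitted (lab q) i ++ l) rf'.

Definition exec c rf l rf' := trace (entry c) rf l rf'.

Lemma exec_seq c1 c2 rf l1 rf1 l2 rf2 :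
  exec c1 rf l1 rf1 -> exec c2 rf1 l2 rf2 -> exec (Seq c1 c2) rf (l1 ++ l2) rf2.
Proof.
move=> T1 T2; have {T2} : trace (inr (entry c2) : ctl (Seq c1 c2)) rf1 l2 rf2.
  elim: T2 => {rf rf1 rf2 l1 l2 T1} [q rf i H|q q' rf i l rf' H _ IH].
    by apply: (@trace_exit (Seq c1 c2) (inr q)); rewrite /= H.
  by apply: (@trace_step (Seq c1 c2) (inr q) (inr q')) IH; rewrite /= H.
rewrite /exec /=; elim: T1 => [q rf' i H|q q' rf' i l rf'' H _ IH] T.
  by apply: (@trace_step (Seq c1 c2) (inl q)) T; rewrite /= H.
by rewrite -catA; apply: (@trace_step (Seq c1 c2) (inl q)) (IH T); rewrite /= H.
Qed.

Variable i0 : I.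

Lemma exec_while0 r c rf : rf r = 0 -> exec (While r c) rf [::] rf.
Proof. by move=> H; apply: (@trace_exit (While r c) None rf i0); rewrite /= /nz H. Qed.

Lemma exec_whileS r c rf l1 rf1 l2 rf2 : rf r != 0 -> exec c rf l1 rf1 ->
  exec (While r c) rf1 l2 rf2 -> exec (While r c) rf (l1 ++ l2) rf2.
Proof.
move=> H T1 T2; apply: (@trace_step (While r c) None (Some (entry c)) rf i0); first by rewrite /= /nz H.
rewrite /=; elim: T1 T2 => [q rf' i H'|q q' rf' i l rf'' H' _ IH] T.
  by apply: (@trace_step (While r c) (Some q)) T; rewrite /= H'.
by rewrite -catA; apply: (@trace_step (While r c) (Some q)) (IH T); rewrite /= H'.
Qed.

Lemma exec_ifT r c1 c2 rf l rf' : rf r != 0 -> exec c1 rf l rf' -> exec (If r c1 c2) rf l rf'.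
Proof.
move=> H T; apply: (@trace_step (If r c1 c2) None (Some (inl (entry c1))) rf i0).
  by rewrite /= /nz H.
rewrite /=; elim: T => {H} [q rf1 i H|q q' rf1 i l1 rf2 H _ IH].
  by apply: (@trace_exit (If r c1 c2) (Some (inl q))); rewrite /= H.
by apply: (@trace_step (If r c1 c2) (Some (inl q)) (Some (inl q'))) IH; rewrite /= H.
Qed.

Lemma exec_ifF r c1 c2 rf l rf' : rf r = 0 -> exec c2 rf l rf' -> exec (If r c1 c2) rf l rf'.
Proof.
move=> H T; apply: (@trace_step (If r c1 c2) None (Some (inr (entry c2))) rf i0).
  by rewrite /= /nz H.
rewrite /=; elim: T => {H} [q rf1 i H|q q' rf1 i l1 rf2 H _ IH].
  by apply: (@trace_exit (If r c1 c2) (Some (inr q))); rewrite /= H.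
by apply: (@trace_step (If r c1 c2) (Some (inr q)) (Some (inr q'))) IH; rewrite /= H.
Qed.

Lemma exec_asg d s op rf : exec (Asg d s op) rf [::] (upd rf (Some (d, s, op))).
Proof. exact: (@trace_exit (Asg d s op) tt rf i0). Qed.

Lemma exec_emit b rf : exec (Emit b) rf [:: inl b] rf.
Proof. exact: (@trace_exit (Emit b) tt rf i0). Qed.

Lemma exec_input d i rf : exists rf', exec (Input d) rf [:: inr i] rf' /\
  rf' d = rf d + enc_fin i /\ forall r, r != d -> rf' r = rf r.
Proof.
have [rf' [T H]] : exists rf', trace (Some (enum_rank i) : ctl (Input d)) rf [::] rf' /\
    rf' d = rf d + enum_rank i /\ forall r, r != d -> rf' r = rf r.
  case: (enum_rank i) => k /=; elim: k rf => [|k IH] rf lt.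
    exists rf; rewrite addn0; split=> //.
    exact: (@trace_exit (Input d) (Some (Ordinal lt)) rf i0).
  have [rf' [T [Hd Hr]]] := IH (upd rf (Some (d, d, CInc))) (ltnW lt).
  exists rf'; split; last first.
    split; first by rewrite Hd /= eqxx /= addSnnS.
    by move=> r nr; rewrite Hr //= (negbTE nr).
  apply: (@trace_step (Input d) (Some (Ordinal lt)) (Some (Ordinal (ltnW lt))) rf i0) T.
  by rewrite /=; congr Some; exact: (insubT (fun j => j < N) (ltnW lt)).
by exists rf'; split=> //; exact: (@trace_step (Input d) None _ rf i).
Qed.

Definition Clr d := While d (Asg d d CDec).

Lemma exec_clr d rf : exists rf', exec (Clr d) rf [::] rf' /\
  rf' d = 0 /\ forall r, r != d -> rf' r = rf r.
Proof.
move E: (rf d) => n; elim: n rf E => [|n IH] rf E.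
  by exists rf; split=> //; exact: exec_while0.
have [|rf' [T [Hd Hr]]] := IH (upd rf (Some (d, d, CDec))); first by rewrite /= eqxx E.
exists rf'; split; last by split=> // r nr; rewrite Hr //= (negbTE nr).
by apply: (exec_whileS (l1 := [::]) _ (exec_asg _ _ _ _) T); rewrite E.
Qed.

(** [comp] is a parameter outside the fixpoint, so that [compile] can call itself on the elements of
    the list [gs]. *)
Definition args (comp : mu -> nat -> cmd) (last : nat -> cmd) :=
  fix args gs m := if gs is g :: gs' then Seq (comp g m) (args gs' m.+1) else last m.

(* The value ends up in register [n], and no register below [n] is modified. *)
Fixpoint compile (e : mu) (xs : seq nat) (n : nat) : cmd :=
  match e with
  | MZero => Clr n
  | MSucc => if xs is x :: _ then Asg n x CInc else Seq (Clr n) (Asg n n CInc)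
  | MProj i => if i < size xs then Asg n (nth 0 xs i) CStay else Clr n
  | MComp f gs =>
      args (fun g m => compile g xs m)
        (fun m => Seq (compile f (iota n (m - n)) m) (Asg n m CStay)) gs n
  | MPrec f g =>
      if xs is x :: xs' then
        Seq (compile f xs' n) (Seq (Clr n.+1) (Seq (Asg n.+2 x CStay)
          (While n.+2 (Seq (compile g [:: n.+1, n & xs'] n.+3) (Seq (Asg n n.+3 CStay)
             (Seq (Asg n.+1 n.+1 CInc) (Asg n.+2 n.+2 CDec)))))))
      else Clr n
  | MMin f =>
      Seq (Clr n) (Seq (compile f (n :: xs) n.+1)
        (While n.+1 (Seq (Asg n n CInc) (compile f (n :: xs) n.+1))))
  end.

(** Nothing is assumed about the registers from [n] on, so a program may be run again in a loop
    without cleaning up. *)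
Definition correct e := forall xs n rf v, all (fun x => x < n) xs ->
  mu_eval e [seq rf x | x <- xs] v ->
  exists rf', exec (compile e xs n) rf [::] rf' /\ rf' n = v /\ forall r, r < n -> rf' r = rf r.

Fixpoint mu_rect_nested (P : mu -> Prop) (PZ : P MZero) (PS : P MSucc) (PP : forall i, P (MProj i))
  (PC : forall f gs, P f -> (forall g, List.In g gs -> P g) -> P (MComp f gs))
  (PR : forall f g, P f -> P g -> P (MPrec f g)) (PM : forall f, P f -> P (MMin f)) e : P e :=
  let rec := mu_rect_nested PZ PS PP PC PR PM in
  match e with
  | MZero => PZ | MSucc => PS | MProj i => PP i
  | MComp f gs => PC f gs (rec f) ((fix go l : forall g, List.In g l -> P g :=
      match l with
      | [::] => fun g H => match H with end
      | g0 :: l' => fun g H => match H with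
          | or_introl E => match E with erefl => rec g0 end
          | or_intror H' => go l' g H' end end) gs)
  | MPrec f g => PR f g (rec f) (rec g) | MMin f => PM f (rec f)
  end.

Lemma compile_correct e : correct e.
Proof.
elim/mu_rect_nested: e => [||i|f gs IHf IHgs|f g IHf IHg|f IHf] xs n rf v Hxs ev.
- inversion ev; subst; have [rf' [T [H1 H2]]] := exec_clr n rf.
  by exists rf'; split=> //; split=> // r lt; apply: H2; lia.
- inversion ev; subst; case: xs Hxs ev => [|x xs] /= Hxs ev.
    have [rf' [T [H1 H2]]] := exec_clr n rf.
    exists (upd rf' (Some (n, n, CInc))); split; last first.
      split; first by rewrite /= eqxx H1.
      by move=> r lt; rewrite /= ifF ?H2 //; lia.
    exact: (exec_seq T (exec_asg _ _ _ _)).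
  exists (upd rf (Some (n, x, CInc))); split; first exact: exec_asg.
  split; first by rewrite /= eqxx.
  by move=> r lt; rewrite /= ifF //; lia.
- inversion ev; subst => /=; case: ltnP => lt.
    exists (upd rf (Some (n, nth 0 xs i, CStay))); split; first exact: exec_asg.
    split; first by rewrite /= eqxx (nth_map 0).
    by move=> r lt'; rewrite /= ifF //; lia.
  have [rf' [T [H1 H2]]] := exec_clr n rf.
  exists rf'; split=> //; split; first by rewrite H1 nth_default // size_map.
  by move=> r lt'; apply: H2; lia.
- inversion ev as [| | |? ? ? ys ? Hgs Hf| | |]; subst => /=.
  (* The arguments already evaluated occupy the registers from [n] to [m - 1]; [ys0] carries their
     values through the induction on the remaining ones. *)
  suff H : forall m rf1 ys0 ys', n <= m -> (forall r, r < n -> rf1 r = rf r) ->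
      mu_evals gs [seq rf x | x <- xs] ys' -> ys0 = [seq rf1 x | x <- iota n (m - n)] ->
      mu_eval f (ys0 ++ ys') v -> exists rf', exec (args (fun g m => compile g xs m)
        (fun m => Seq (compile f (iota n (m - n)) m) (Asg n m CStay)) gs m) rf1 [::] rf' /\
        rf' n = v /\ forall r, r < n -> rf' r = rf r.
    by apply: (H n rf [::] ys) => //; rewrite subnn.
  elim: gs IHgs {ev Hgs Hf} => [|g gs IH] IHgs m rf1 ys0 ys' le Ern Hgs Ey Hf.
    inversion Hgs; subst; rewrite cats0 in Hf.
    have [|rf2 [T [H1 H2]]] := IHf (iota n (m - n)) m rf1 v _ Hf.
      by apply/allP => x; rewrite mem_iota subnKC // => /andP[].
    exists (upd rf2 (Some (n, m, CStay))); split.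
      exact: (exec_seq T (exec_asg _ _ _ _)).
    split; first by rewrite /= eqxx.
    by move=> r lt; rewrite /= ifF ?H2 ?Ern //; lia.
  inversion Hgs as [|? ? ? y ys1 Hg Hgs']; subst.
  have Exs : [seq rf x | x <- xs] = [seq rf1 x | x <- xs].
    by apply/eq_in_map => x /(allP Hxs) /Ern.
  have [||rf2 [T [H1 H2]]] := IHgs g (or_introl erefl) xs m rf1 y; [|by rewrite -Exs|].
    by apply: sub_all Hxs => x /leq_trans; apply.
  have [|||||rf3 [T3 [H3 H4]]] := IH (fun g' H => IHgs g' (or_intror H)) m.+1 rf2 ([seq rf1 x | x <- iota n (m - n)] ++ [:: y]) ys1.
  - exact: leqW.
  - by move=> r lt; rewrite H2 ?Ern //; lia.
  - by [].
  - rewrite subSn // -addn1 iotaD map_cat /= subnKC // H1; congr (_ ++ _).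
    by apply/eq_in_map => x; rewrite mem_iota subnKC // => /andP[_ /H2].
  - by rewrite -catA.
  exists rf3; split=> //; exact: (exec_seq T T3).
- case: xs Hxs ev => [|x xs] Hxs ev; first by inversion ev.
  have /andP[/= xn xsn] := Hxs.
  (* The evaluation descends from [rf x], the loop ascends from 0: the intermediate values are first
     collected in a sequence [ac]. *)
  have [r0 Hf Hloop] : exists2 r0, mu_eval f [seq rf x | x <- xs] r0 &
      exists ac : nat -> nat, [/\ ac 0 = r0, ac (rf x) = v & forall k, k < rf x ->
        mu_eval g [:: k, ac k & [seq rf x | x <- xs]] (ac k.+1)].
    move: ev => /=; elim: (rf x) v => [|k IH] v ev.
      by inversion ev; subst; exists v => //; exists (fun=> v).
    inversion ev; subst; have [r0 Hf [ac [H1 H2 H3]]] := IH _ H4.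
    exists r0 => //; exists (fun m => if m <= k then ac m else v); split=> //; first by rewrite ltnn.
    move=> m; rewrite ltnS => le; rewrite le; case: (ltnP m k) => lt; first exact: H3.
    by rewrite (_ : m = k) ?H2 //; lia.
  have [ac [H1 H2 H3]] := Hloop => /=.
  have [rf1 [T1 [E1 R1]]] := IHf xs n rf r0 xsn Hf.
  have [rf2 [T2 [E2 R2]]] := exec_clr n.+1 rf1.
  set rf3 := upd rf2 (Some (n.+2, x, CStay)).
  (* Accumulator, index, number of passes left, and the untouched arguments. *)
  pose J k (rf' : regs) := [/\ rf' n = ac k, rf' n.+1 = k, rf' n.+2 = rf x - k &
     forall r, r < n -> rf' r = rf r].
  have I3 : J 0 rf3.
    split; rewrite /rf3 /= ?eqxx.
    - by rewrite ifF ?R2 ?E1 //; lia.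
    - by rewrite ifF ?E2 //; lia.
    - by rewrite subn0 R2 ?R1 //; lia.
    - by move=> r lt; rewrite ifF ?R2 ?R1 //; lia.
  set body := Seq (compile g _ _) _.
  have loop d k rf' : k + d = rf x -> J k rf' -> exists rf'',
      exec (While n.+2 body) rf' [::] rf'' /\ J (rf x) rf''.
    elim: d k rf' => [|d IH] k rf' Ek Ik.
      exists rf'; rewrite -Ek addn0 in Ik *; split=> //; apply: exec_while0.
      by have [_ _ -> _] := Ik; rewrite -Ek addn0 subnn.
    have [J1 J2 J3 J4] := Ik.
    have lt : k < rf x by lia.
    have Exs : [seq rf' x | x <- [:: n.+1, n & xs]] = [:: k, ac k & [seq rf x | x <- xs]].
      rewrite /= J1 J2; congr [:: _, _ & _]; apply/eq_in_map => r Hr.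
      by apply: J4; exact: (allP xsn).
    have [||rf4 [T4 [E4 R4]]] := IHg [:: n.+1, n & xs] n.+3 rf' (ac k.+1).
    - by rewrite /= !ltnS leqnSn leqW //=; apply: sub_all xsn => r; lia.
    - by rewrite Exs; exact: H3.
    set rf5 := upd rf4 (Some (n, n.+3, CStay)).
    set rf6 := upd rf5 (Some (n.+1, n.+1, CInc)).
    set rf7 := upd rf6 (Some (n.+2, n.+2, CDec)).
    have [||rf8 [T8 I8]] := IH k.+1 rf7; first by rewrite addSnnS.
      have D : ((n == n.+1) = false) * ((n == n.+2) = false) * ((n.+1 == n) = false) *
        ((n.+1 == n.+2) = false) * ((n.+2 == n) = false) * ((n.+2 == n.+1) = false) by do !split; lia.
      split; rewrite /rf7 /rf6 /rf5 /= ?eqxx !D ?eqxx ?E4 //.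
      - by rewrite R4 ?J2.
      - by rewrite R4 // J3 subnS.
      - move=> r ltr; rewrite !ifF ?R4 ?J4 //; lia.
    exists rf8; split=> //; apply: (exec_whileS (l1 := [::]) _ _ T8); first by rewrite J3; lia.
    apply: (exec_seq (l1 := [::]) T4); apply: (exec_seq (l1 := [::]) (exec_asg _ _ _ _)).
    by apply: (exec_seq (l1 := [::]) (exec_asg _ _ _ _)); exact: exec_asg.
  have [rf9 [T9 [J1 J2 J3 J4]]] := loop (rf x) 0 rf3 erefl I3.
  exists rf9; split; last by rewrite J1 H2.
  apply: (exec_seq (l1 := [::]) T1); apply: (exec_seq (l1 := [::]) T2).
  by apply: (exec_seq (l1 := [::]) (exec_asg _ _ _ _)).
- have sub : all (fun x => x < n.+1) (n :: xs).
    by rewrite /= ltnSn; apply: sub_all Hxs => r; lia.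
  inversion ev as [| | | | | |? ? ? Hv Hm]; subst => /=.
  have [rf1 [T1 [E1 R1]]] := exec_clr n rf.
  set c := compile f _ _.
  (* The values are constrained up to [v] only; beyond it [f] may be undefined. *)
  have [val [Hval Hz Hnz]] : exists val, [/\ forall k, k <= v ->
      mu_eval f (k :: [seq rf x | x <- xs]) (val k), val v = 0 & forall k, k < v -> val k != 0].
    have ex k : exists y, k <= v -> mu_eval f (k :: [seq rf x | x <- xs]) y /\ ((y == 0) = (k == v)).
      case: (ltngtP k v) => [lt|gt|->]; [|by exists 0|by exists 0].
      by have [y [ny Hy]] := Hm k lt; exists y => _; split=> //; case: eqP ny.
    have [val Hval] := choice ex; exists val; split.
    - by move=> k /Hval [].
    - by apply/eqP; have [_ ->] := Hval v (leqnn _).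
    - by move=> k lt; have [_ ->] := Hval k (ltnW lt); rewrite ltn_eqF.
  have run k rf' : k <= v -> rf' n = k -> (forall r, r < n -> rf' r = rf r) ->
      exists rf'', [/\ exec c rf' [::] rf'', rf'' n = k, rf'' n.+1 = val k &
        forall r, r < n -> rf'' r = rf r].
    move=> le Ek Er; have [||rf'' [T [E R]]] := IHf (n :: xs) n.+1 rf' (val k) => //.
      rewrite /= Ek (_ : [seq rf' x | x <- xs] = [seq rf x | x <- xs]); first exact: Hval.
      by apply/eq_in_map => r Hr; apply: Er; exact: (allP Hxs).
    by exists rf''; split=> //; [rewrite R|move=> r lt; rewrite R ?Er //; lia].
  have [|r lt|rf2 [T2 N2 V2 R2]] := run 0 rf1 _ E1; [by []|by apply: R1; lia|].
  have loop d k rf' : k + d = v -> rf' n = k -> rf' n.+1 = val k ->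
      (forall r, r < n -> rf' r = rf r) -> exists rf'',
      exec (While n.+1 (Seq (Asg n n CInc) c)) rf' [::] rf'' /\ rf'' n = v /\
      forall r, r < n -> rf'' r = rf r.
    elim: d k rf' => [|d IH] k rf' Ek N' V' R'.
      exists rf'; rewrite addn0 in Ek; subst k; split=> //.
      by apply: exec_while0; rewrite V' -[in RHS]Hz Ek.
    have lt : k < v by lia.
    have [||r lt'|rf3 [T3 N3 V3 R3]] := run k.+1 (upd rf' (Some (n, n, CInc))).
    - by [].
    - by rewrite /= eqxx N'.
    - by rewrite /= ifF ?R' //; lia.
    have [|rf4 [T4 H4]] := IH k.+1 rf3 _ N3 V3 R3; first by rewrite addSnnS.
    exists rf4; split=> //; apply: (exec_whileS (l1 := [::]) _ _ T4).
      by rewrite V'; exact: Hnz.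
    exact: (exec_seq (l1 := [::]) (exec_asg _ _ _ _) T3).
  have [rf5 [T5 H5]] := loop v 0 rf2 erefl N2 V2 R2.
  exists rf5; split=> //; apply: (exec_seq (l1 := [::]) T1).
  exact: (exec_seq (l1 := [::]) T2 T5).
Qed.

Section CmdMachine.
Variable c : cmd.
Notation K := (maxreg c).+1.

Definition pattern (p : {ffun 'I_K -> bool}) r := if insub r is Some j then p j else false.

(** Leaving the command leads back to its entry, so the machine iterates [c] for ever. By
    [asg_maxreg] the source given to [insubd] is always in range. *)
Definition cmd_machine : machine I := @Machine I (ctl c) K (entry c)
  (fun q p i => odflt (entry c) (nxt q (pattern p) i))
  (fun q j => if asg q is Some (d, s, op) then if j == d :> nat then insubd j s else j else j)
  (fun q j => if asg q is Some (d, s, op) then if j == d :> nat then op else CStay else CStay)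
  (@lab c).
Notation M := cmd_machine.

Variable z : nat -> I.
Definition at_time n (q : ctl c) (rf : regs) :=
  (mrun M z n).1 = q /\ forall j, (mrun M z n).2 j = rf j.

Lemma at_step n q rf : at_time n q rf ->
  at_time n.+1 (odflt (entry c) (nxt q (nz rf) (z n))) (upd rf (asg q)).
Proof.
rewrite /at_time /= => -[-> H]; split.
  congr odflt; apply: nxt_ext => r le; rewrite /pattern (insubT (fun j => j < K) (le : r < K)).
  by rewrite ffunE H.
move=> j; rewrite /upd; case E: (asg q) => [[[d s] op]|] /=; last by rewrite H.
by have le := asg_maxreg E; case: (j == d :> nat); rewrite H ?insubdK.
Qed.

Lemma incountS n q rf : at_time n q rf ->
  incount M z n.+1 = incount M z n + (lab q == Some None).
Proof. by case=> <-. Qed.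

Lemma evcountS n q rf : at_time n q rf ->
  evcount M z n.+1 = evcount M z n + isSome (lab q).
Proof. by case=> <-. Qed.

Lemma at_step_indep n q rf i : lab q <> Some None -> at_time n q rf ->
  at_time n.+1 (odflt (entry c) (nxt q (nz rf) i)) (upd rf (asg q)).
Proof. by move=> Hl /at_step; rewrite (@nxt_indep c q _ _ i). Qed.

Lemma run_silent q rf rf' n : trace q rf [::] rf' -> at_time n q rf ->
  exists n', [/\ at_time n' (entry c) rf', evcount M z n' = evcount M z n &
                 incount M z n' = incount M z n].
Proof.
move El: [::] => l T; elim: T n El => {q rf l rf'} [q rf i H|q q' rf i l rf' H _ IH] n El At.
  have Hl : lab q = None by move: El; case: (lab q) => [[]|].
  exists n.+1; rewrite (incountS At) (evcountS At) Hl !addn0; split=> //.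
  by have := @at_step_indep n q rf i; rewrite Hl H; apply.
have Hl : lab q = None by move: El; case: (lab q) => [[]|].
have At' : at_time n.+1 q' (upd rf (asg q)).
  by have := @at_step_indep n q rf i; rewrite Hl H; apply.
have [|n' [A1 A2 A3]] := IH n.+1 _ At'; first by move: El; rewrite Hl.
exists n'; split=> //.
  by rewrite A2 (evcountS At) Hl addn0.
by rewrite A3 (incountS At) Hl addn0.
Qed.

Definition event_of (e : bool + I) : event := if e is inl b then Some b else None.

Lemma nxt_input q rf i n e l : at_time n q rf -> [:: e] = emitted (lab q) i ++ l ->
  (forall j, e = inr j -> isin (mrun M z n).1 -> z n = j) ->
  nxt q (nz rf) (z n) = nxt q (nz rf) i.
Proof.
move=> At El Hz; have [Hin|nin] := eqVneq (lab q) (Some None); last first.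
  by apply: nxt_indep; exact/eqP.
move: El; rewrite Hin => -[Ee _]; rewrite (Hz i Ee) //.
by rewrite /isin; case: At => ->; rewrite /= Hin.
Qed.

(** The time of the reading is not known beforehand, so the hypothesis on [z] identifies it by the
    number of inputs read before. *)
Lemma run_event q rf e rf' n : trace q rf [:: e] rf' -> at_time n q rf ->
  (forall i n1, e = inr i -> isin (mrun M z n1).1 -> incount M z n1 = incount M z n -> z n1 = i) ->
  exists n1 n', [/\ mlab (mrun M z n1).1 = Some (event_of e), evcount M z n1 = evcount M z n,
    at_time n' (entry c) rf', evcount M z n' = (evcount M z n).+1 &
    incount M z n' = incount M z n + (event_of e == None)].
Proof.
move El: [:: e] => l T; elim: T n El => {q rf l rf'} [q rf i H|q q' rf i l rf' H T IH] n El At Hz.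
  have Hl : lab q = Some (event_of e) by move: El; case: (lab q) => [[b|]|] //= -[->].
  exists n, n.+1; rewrite (incountS At) (evcountS At) Hl addn1; split=> //.
    by case: At => ->.
  by have := at_step At; rewrite (nxt_input (e := e) (l := [::]) (i := i) At) ?cats0 ?H // => j Ej Hj; exact: Hz.
case Hl : (lab q) => [e'|] in El.
  have [Ee El'] : e' = event_of e /\ l = [::] by move: El; case: e' {Hl} => [b|] -[-> <-].
  have At' : at_time n.+1 q' (upd rf (asg q)).
    by have := at_step At; rewrite (nxt_input (e := e) (l := l) (i := i) At) ?Hl ?H // => j Ej Hj; exact: Hz.
  rewrite El' in T; have [n' [A1 A2 A3]] := run_silent T At'.
  exists n, n'; rewrite A2 A3 (incountS At) (evcountS At) Hl addn1 -Ee; split=> //.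
  by case: At => ->.
have At' : at_time n.+1 q' (upd rf (asg q)).
  by have := @at_step_indep n q rf i; rewrite Hl H; apply.
have [||n1 [n' [A1 A2 A3 A4 A5]]] := IH n.+1 _ At'; first by [].
  by move=> j n1 Ej Hn1; rewrite (incountS At) Hl addn0; exact: Hz.
exists n1, n'; move: A2 A4 A5; rewrite (evcountS At) (incountS At) Hl !addn0 => *; by split.
Qed.

End CmdMachine.

Section TransducerMachine.
Context {Z : Type} {eZ : Enc Z} (z0 : Z).
Variables (G : Z -> event) (FE : Z -> Z) (FI : Z * I -> Z).
(** The machine starts with empty registers, which must already represent the initial state. *)
Hypothesis z0_enc : enc z0 = 0.
Hypothesis CG : Comp (fun z => if G z is Some b then nat_of_bool b else 2).
Hypothesis CFE : Comp FE.
Hypothesis CFI : @Comp _ _ (@enc_prod _ _ eZ (@enc_fin I)) eZ FI.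

Fixpoint trajectory (x : nat -> I) (n : nat) : Z * nat :=
  if n is n'.+1 then
    let: (z, k) := trajectory x n' in
    if G z is None then (FI (z, x k), k.+1) else (FE z, k)
  else (z0, 0).

(* Register 0 holds the code of the state; 1 and 2 the event and the letter read. *)
Definition transducer_cmd eG eFE eFI :=
  let update e xs := Seq (compile e xs 3) (Asg 0 3 CStay) in
  Seq (compile eG [:: 0] 1)
    (If 1 (Seq (Asg 1 1 CDec)
             (If 1 (Seq (Clr 2) (Seq (Input 2) (update (MComp eFI [:: mu_pair]) [:: 0; 2])))
                   (Seq (Emit true) (update eFE [:: 0]))))
          (Seq (Emit false) (update eFE [:: 0]))).

Lemma exec_update e xs rf v : all (fun x => x < 3) xs -> mu_eval e [seq rf x | x <- xs] v ->
  exists rf', exec (Seq (compile e xs 3) (Asg 0 3 CStay)) rf [::] rf' /\ rf' 0 = v.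
Proof.
move=> Hxs ev; have [rf1 [T [E _]]] := compile_correct Hxs ev.
exists (upd rf1 (Some (0, 3, CStay))); split; last by rewrite /= E.
exact: (exec_seq (l1 := [::]) T (exec_asg _ _ _ _)).
Qed.

Lemma transducer_machine : exists M : machine I, forall x z,
  (forall n, isin (mrun M z n).1 -> z n = x (incount M z n)) ->
  (forall N, exists n, N <= evcount M z n) /\
  (forall n e, mlab (mrun M z n).1 = Some e -> e = G (trajectory x (evcount M z n)).1) /\
  (forall k, exists n, evcount M z n = k /\ incount M z n = (trajectory x k).2).
Proof.
have [eG HG] := CG; have [eFE HFE] := CFE; have [eFI HFI] := CFI.
set c := transducer_cmd eG eFE eFI; pose M := cmd_machine c.
exists M => x z Hz.
have body rf st i : rf 0 = enc st -> exists rf',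
    exec c rf [:: if G st is Some b then inl b else inr i] rf' /\
    rf' 0 = enc (if G st is None then FI (st, i) else FE st).
  move=> E0.
  have [|rf1 [T1 [E1 R1]]] := @compile_correct eG [:: 0] 1 rf
    (if G st is Some b then nat_of_bool b else 2) isT.
    by rewrite /= E0; exact: HG.
  have {}E0 : rf1 0 = eZ st by rewrite R1.
  case EG: (G st) E1 => [[]|] /= E1.
  - have [|rf2 [T2 E2]] := @exec_update eFE [:: 0] (upd rf1 (Some (1, 1, CDec))) (enc (FE st)) isT.
      by rewrite /= E0; exact: HFE.
    exists rf2; split=> //; apply: (exec_seq (l1 := [::]) T1).
    apply: exec_ifT; first by rewrite E1.
    apply: (exec_seq (l1 := [::]) (exec_asg _ _ _ _)).
    apply: exec_ifF; first by rewrite /= E1.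
    exact: (exec_seq (exec_emit _ _) T2).
  - have [|rf2 [T2 E2]] := @exec_update eFE [:: 0] rf1 (enc (FE st)) isT.
      by rewrite /= E0; exact: HFE.
    exists rf2; split=> //; apply: (exec_seq (l1 := [::]) T1).
    by apply: exec_ifF => //; exact: (exec_seq (exec_emit _ _) T2).
  - have [rf2 [T2 [E2 R2]]] := exec_clr 2 (upd rf1 (Some (1, 1, CDec))).
    have [rf3 [T3 [E3 R3]]] := exec_input 2 i rf2.
    have [|rf4 [T4 E4]] := @exec_update (MComp eFI [:: mu_pair]) [:: 0; 2] rf3 (enc (FI (st, i))) isT.
      by rewrite /= E3 R3 // R2 //= E0 E2; apply: mu_comp1 (mu_pairP _ _) (HFI (st, i)).
    exists rf4; split=> //; apply: (exec_seq (l1 := [::]) T1).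
    apply: exec_ifT; first by rewrite E1.
    apply: (exec_seq (l1 := [::]) (exec_asg _ _ _ _)).
    apply: exec_ifT; first by rewrite /= E1.
    by apply: (exec_seq (l1 := [::]) T2); exact: (exec_seq T3 T4).
have loop k : exists n rf, [/\ @at_time c z n (entry c) rf, evcount M z n = k,
    incount M z n = (trajectory x k).2 & rf 0 = enc (trajectory x k).1].
  elim: k => [|k [n [rf [At Ek Ei E0]]]]; first by exists 0, (fun=> 0); split=> //; rewrite z0_enc.
  have [rf' [T E']] := body rf _ (x (incount M z n)) E0.
  have [|n1 [n' [A1 A2 A3 A4 A5]]] := run_event T At.
    by move=> i n1; case: (G _) => // -[<-] Hin En1; rewrite Hz // En1.
  exists n', rf'; split=> //; first by rewrite A4 Ek.
    by rewrite A5 Ei /=; case: (trajectory x k) => st m /=; case: (G st) => [b|] /=; lia.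
  by rewrite E' Ei /=; case: (trajectory x k) => st m /=; case: (G st).
split; first by move=> N; have [n [rf [_ <- _ _]]] := loop N; exists n.
split; last by move=> k; have [n [rf [_ ? ? _]]] := loop k; exists n.
move=> n e He; set k := evcount M z n.
have [m [rf [At Ek Ei E0]]] := loop k.
have [rf' [T E']] := body rf _ (x (incount M z m)) E0.
have [|n1 [n' [A1 A2 A3 A4 A5]]] := run_event T At.
  by move=> i n1; case: (G _) => // -[<-] Hin En1; rewrite Hz // En1.
(* Two emitting times with the same number of earlier events coincide, so the event at time [n] is
   the one of the pass with number [k]. *)
have En : n = n1.
  apply: (@kount_inj (fun n => isSome (mlab (mrun M z n).1))); rewrite ?He ?A1 //.
  by rewrite -/(evcount M z n) -/(evcount M z n1) A2 Ek.
by move: He; rewrite En A1 => -[<-]; case: (G _).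
Qed.

End TransducerMachine.
End Cmd.

(** * Effective analytic sets as pointer languages *)

Section CompArith.
Context {A B : Type} {eA : Enc A} {eB : Enc B}.

Lemma Comp_add (m n : A -> nat) : Comp m -> Comp n -> Comp (fun a => m a + n a).
Proof.
move=> [em Hm] [en Hn]; exists (MComp mu_add [:: em; en]) => a.
exact: mu_comp2 (Hm a) (Hn a) (mu_addP _ _).
Qed.

Lemma Comp_sub (m n : A -> nat) : Comp m -> Comp n -> Comp (fun a => m a - n a).
Proof.
move=> [em Hm] [en Hn]; exists (MComp mu_rsub [:: en; em]) => a.
exact: mu_comp2 (Hn a) (Hm a) (mu_rsubP _ _).
Qed.

Lemma Comp_nat_of_bool (b : A -> bool) : Comp b -> Comp (fun a => nat_of_bool (b a)).
Proof. by case=> e He; exists e. Qed.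
End CompArith.

Ltac comp_proj := repeat match goal with
  | |- @Comp _ _ _ _ (fun p => fst (@?f p)) => refine (@Comp_fst _ _ _ _ _ _ f _)
  | |- @Comp _ _ _ _ (fun p => snd (@?f p)) => refine (@Comp_snd _ _ _ _ _ _ f _)
  | |- @Comp _ _ _ _ snd => refine (Comp_snd Comp_id)
  | |- @Comp _ _ _ _ fst => refine (Comp_fst Comp_id)
  | |- @Comp _ _ _ _ (fun p => p) => refine Comp_id
  end.

Section CompArith2.
Context {A B : Type} {eA : Enc A} {eB : Enc B}.

Lemma Comp_odd (n : A -> nat) : Comp n -> Comp (fun a => odd (n a)).
Proof.
move=> Cn; have Ch : Comp (fun p : A * (nat * bool) => if p.2.2 then false else true).
  by apply: Comp_if; [comp_proj|exact: Comp_const|exact: Comp_const].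
apply: Comp_ext (Comp_rec Cn (Comp_const false) Ch) _ => a.
by elim: (n a) => //= m ->; case: (odd m).
Qed.

End CompArith2.

Section CompArith3.
Context {A B : Type} {eA : Enc A} {eB : Enc B}.

Lemma Comp_half (n : A -> nat) : Comp n -> Comp (fun a => (n a)./2).
Proof.
move=> Cn; have Ch : Comp (fun p : A * (nat * nat) => p.2.2 + nat_of_bool (odd p.2.1)).
  by apply: Comp_add; [comp_proj|apply: Comp_nat_of_bool; apply: Comp_odd; comp_proj].
apply: Comp_ext (Comp_rec Cn (Comp_const 0) Ch) _ => a.
by elim: (n a) => //= m ->; rewrite uphalf_half addnC.
Qed.

Lemma Comp_exp2 (n : A -> nat) : Comp n -> Comp (fun a => 2 ^ n a).
Proof.
move=> Cn; have Ch : Comp (fun p : A * (nat * nat) => p.2.2 + p.2.2).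
  by apply: Comp_add; comp_proj.
apply: Comp_ext (Comp_rec Cn (Comp_const 1) Ch) _ => a.
by elim: (n a) => //= m ->; rewrite expnS mul2n addnn.
Qed.

Lemma Comp_or (b b' : A -> bool) : Comp b -> Comp b' -> Comp (fun a => b a || b' a).
Proof.
by move=> Cb Cb'; apply: Comp_ext (Comp_if Cb (Comp_const true) Cb') _ => a; case: (b a).
Qed.

Lemma Comp_pred (n : A -> nat) : Comp n -> Comp (fun a => (n a).-1).
Proof. by case=> e He; exists (MComp mu_pred [:: e]) => a; exact: mu_comp1 (He a) (mu_predP _). Qed.

Lemma Comp_take (k : A -> nat) (l : A -> seq B) :
  Comp k -> Comp l -> Comp (fun a => take (k a) (l a)).
Proof.
move=> Ck Cl.
pose step (p : A * (seq B * seq B)) : seq B * seq B :=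
  if p.2.2 is x :: r then (x :: p.2.1, r) else p.2.
have Cs : Comp step.
  have C1 : Comp (fun q : (A * (seq B * seq B)) * (B * seq B) => (q.2.1 :: q.1.2.1, q.2.2)).
    by apply: Comp_pair; [apply: Comp_cons|]; comp_proj.
  by apply: (Comp_seqcase _ _ C1); comp_proj.
have C1 := Comp_fst (Comp_iter Ck (Comp_pair (Comp_const ([::] : seq B)) Cl) Cs).
apply: (Comp_ext (Comp_rev C1)) => a; rewrite -[RHS]cat0s -[[::] in RHS]/(rev [::]).
elim: (k a) [::] (l a) => [|m IH] acc r; first by rewrite take0 cats0.
by case: r => [|x r]; rewrite iterSr /step /= -/step; [rewrite IH /= cats0|rewrite IH rev_cons cat_rcons].
Qed.
End CompArith3.

Section NormalForm.
Variables (X : finType) (R : nat -> Prop).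
Hypothesis recR : recursive_nat R.
#[local] Instance encX : Enc X := @enc_fin X.

Definition holds_at (n k : nat) (u : seq bool) (w : seq X) : bool :=
  `[< R (code_triple n (take k u) (take k w)) >].
(** Written with [nat_rect] to match [Comp_rec] by conversion. *)
Definition found (N n : nat) (u : seq bool) (w : seq X) : bool :=
  nat_rect (fun=> bool) (holds_at n 0 u w) (fun k b => b || holds_at n k.+1 u w) N.
(* The number of [n] for which a witness has successively been found among the prefixes of
   length less than [m]. *)
Definition progress (m : nat) (u : seq bool) (w : seq X) : nat :=
  nat_rect (fun=> nat) 0 (fun k s => s + found k s u w) m.
(** Inverts [branch_remaining]: half of the index of a node is the number of nodes listed after its
    parent, hence gives the place of the parent in a level of [2 ^ m] nodes; the parity is the last
    bit of the word. *)
Definition parent (p : nat * nat * seq bool) : nat * nat * seq bool :=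
  (p.1.1.-1, 2 ^ p.1.1 - 1 - p.1.2./2, odd p.1.2 :: p.2).
Definition node (m j : nat) : seq bool := (iter m.+1 parent (m, j, [::])).2.
(** The word comes reversed because the transducer stores each new letter at the head of its
    list. *)
Definition label (m j : nat) (wr : seq X) : bool :=
  let u := node m j in let w := rev wr in found m (progress m u w) u w.

Section CompLabel.
Context {A : Type} {eA : Enc A}.
Implicit Types (n k m j : A -> nat) (u : A -> seq bool) (w : A -> seq X).

Lemma Comp_holds_at n k u w : Comp n -> Comp k -> Comp u -> Comp w ->
  Comp (fun a => holds_at (n a) (k a) (u a) (w a)).
Proof.
move=> Cn Ck Cu Cw.
have C1 : Comp (fun q : nat * (seq bool * seq X) => `[< R (code_triple q.1 q.2.1 q.2.2) >]).
  have [e He] := recR; exists e => q; have [H1 H2] := He (code_triple q.1 q.2.1 q.2.2).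
  by case: asboolP; [exact: H1|exact: H2].
exact: (Comp_comp C1 (Comp_pair Cn (Comp_pair (Comp_take Ck Cu) (Comp_take Ck Cw)))).
Qed.
End CompLabel.

Section CompLabel2.
Context {A : Type} {eA : Enc A}.
Implicit Types (n k m j N : A -> nat) (u : A -> seq bool) (w : A -> seq X).

Lemma Comp_found N n u w : Comp N -> Comp n -> Comp u -> Comp w ->
  Comp (fun a => found (N a) (n a) (u a) (w a)).
Proof.
move=> CN Cn Cu Cw; have Cp B (eB : Enc B) (f : A -> B) : Comp f -> Comp (fun p : A * (nat * bool) => f p.1).
  by move=> Cf; apply: (Comp_comp Cf); comp_proj.
have C1 : Comp (fun p : A * (nat * bool) => p.2.2 || holds_at (n p.1) p.2.1.+1 (u p.1) (w p.1)).
  apply: Comp_or; first by comp_proj.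
  by apply: Comp_holds_at; try exact: Cp; apply: Comp_succ; comp_proj.
exact: (Comp_rec CN (Comp_holds_at Cn (Comp_const 0) Cu Cw) C1).
Qed.

Lemma Comp_node m j : Comp m -> Comp j -> Comp (fun a => node (m a) (j a)).
Proof.
move=> Cm Cj; have C1 : Comp (fun p : A * (nat * nat * seq bool) => parent p.2).
  do 2?apply: Comp_pair.
  - by apply: Comp_pred; comp_proj.
  - apply: Comp_sub; first by apply: Comp_sub; [apply: Comp_exp2; comp_proj|exact: Comp_const].
    by apply: Comp_half; comp_proj.
  - by apply: Comp_cons; [apply: Comp_odd|]; comp_proj.
exact: Comp_snd (Comp_iter (Comp_succ Cm) (Comp_pair (Comp_pair Cm Cj) (Comp_const [::])) C1).
Qed.
End CompLabel2.

Section CompLabel3.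
Context {A : Type} {eA : Enc A}.
Implicit Types (n k m j N : A -> nat) (u : A -> seq bool) (w : A -> seq X).

Lemma Comp_progress m u w : Comp m -> Comp u -> Comp w ->
  Comp (fun a => progress (m a) (u a) (w a)).
Proof.
move=> Cm Cu Cw; have Cp B (eB : Enc B) (f : A -> B) : Comp f -> Comp (fun p : A * (nat * nat) => f p.1).
  by move=> Cf; apply: (Comp_comp Cf); comp_proj.
have C1 : Comp (fun p : A * (nat * nat) => p.2.2 + found p.2.1 p.2.2 (u p.1) (w p.1)).
  apply: Comp_add; first by comp_proj.
  by apply: Comp_nat_of_bool; apply: Comp_found; try exact: Cp; comp_proj.
exact: (Comp_rec Cm (Comp_const 0) C1).
Qed.

Lemma Comp_label m j w : Comp m -> Comp j -> Comp w ->
  Comp (fun a => label (m a) (j a) (w a)).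
Proof.
move=> Cm Cj Cw; have Cu := Comp_node Cm Cj; have Cw' := Comp_rev Cw.
by apply: Comp_found => //; exact: Comp_progress.
Qed.
End CompLabel3.

Lemma foundP N n u w : reflect (exists k, k <= N /\ holds_at n k u w) (found N n u w).
Proof.
elim: N => [|N IH]; first by apply: (iffP idP) => [H|[k []]]; [exists 0|case: k].
rewrite /found /= -/(found N n u w); apply: (iffP orP) => [[/IH[k [le H]]|H]|[k [le H]]].
- by exists k; split=> //; exact: leqW.
- by exists N.+1.
case: (ltngtP k N.+1) le => // [lt _|<- _]; last by right.
by left; apply/IH; exists k.
Qed.

Lemma node_branch t m : node m (branch t m) = mkseq t m.+1.
Proof.
suff H acc : (iter m.+1 parent (m, branch t m, acc)).2 = mkseq t m.+1 ++ acc.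
  by rewrite /node H cats0.
elim: m acc => [|m IH] acc; first by rewrite /= /branch /=; case: (t 0).
rewrite iterSr mkseqS cat_rcons -IH; congr (iter _ _ _).2.
have lt := branch_lt t m; rewrite /parent /= [branch t m.+1]/branch halfD odd_double /=.
rewrite doubleK oddD odd_double /= oddb; congr (_, _, _ :: _).
rewrite -/(width m); have -> : (t m.+1)./2 = 0 by case: (t m.+1).
by move: lt; rewrite /branch; lia.
Qed.

Lemma take_mkseq (T : Type) (f : nat -> T) k n : k <= n -> take k (mkseq f n) = mkseq f k.
Proof. by move=> le; rewrite /mkseq -map_take take_iota (minn_idPl le). Qed.

Section Stream.
Variables (t : nat -> bool) (s : nat -> X).
Let holds n k := R (code_triple n (mkseq t k) (mkseq s k)).
Fixpoint advance (m : nat) : nat :=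
  if m is k.+1 then advance k + `[< exists i, i <= k /\ holds (advance k) i >] else 0.
Let hit m := `[< exists i, i <= m /\ holds (advance m) i >].

Lemma found_mkseq N n m l : N <= m -> N <= l ->
  found N n (mkseq t m) (mkseq s l) = `[< exists i, i <= N /\ holds n i >].
Proof.
move=> lem lel; apply/foundP/asboolP => -[k [le H]]; exists k; split=> //; move: H.
  by move/asboolP; rewrite !take_mkseq //; lia.
by move=> H; apply/asboolP; rewrite !take_mkseq //; lia.
Qed.

Lemma label_branch m : label m (branch t m) (rev (mkseq s m.*2)) = hit m.
Proof.
rewrite /label revK node_branch; have -> k : k <= m ->
    progress k (mkseq t m.+1) (mkseq s m.*2) = advance k.
  elim: k => [|k IH] le //; rewrite /progress /= -/(progress k _ _) IH; last by lia.
  by rewrite found_mkseq //; lia.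
- by rewrite found_mkseq //; lia.
- by [].
Qed.

Lemma advance_kount m : advance m = kount hit m.
Proof. by elim: m => //= m IH; rewrite {1}IH. Qed.

(** Each hit settles one requirement and passes to the next, so the hits never stop exactly when
    every requirement can be met. *)
Lemma hits_infinite : (forall n, exists k, holds n k) <-> recurs hit.
Proof.
split=> [H N|H n].
  apply: contrapT => nH; have {}nH m : N <= m -> hit m = false.
    by move=> le; apply/negP => Hm; apply: nH; exists m.
  have [k Hk] := H (advance N).
  have E m : N <= m -> advance m = advance N.
    move=> /subnK <-; elim: (m - N) => // d IH.
    by rewrite addSn /= -/(hit (d + N)) nH ?leq_addl // addn0.
  (* A stage late enough for the witness [k] of the requirement at which [advance] is stuck. *)
  have /negP := nH (maxn k N) (leq_maxr _ _); apply; apply/asboolP; exists k.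
  by rewrite leq_maxl E ?leq_maxr.
have [m [/asboolP[k [_ Hk]] Em]] := kount_pos (kount_unbounded H) n.
by exists k; move: Hk; rewrite advance_kount Em.
Qed.
End Stream.

Section Reduction.
Variables (L : olang X) (x0 : X).
Hypothesis L_R : forall s : oword X, L s <-> exists t : nat -> bool, forall n, exists m,
  R (code_triple n (Defs.prefix t m) (Defs.prefix s m)).

Definition stream_label (s : nat -> X) m j := label m j (rev (mkseq s m.*2)).

Lemma pointer_stream s : oacc pointer (levels (stream_label s)) <-> L s.
Proof.
rewrite pointerP L_R; split=> -[t Ht]; exists t.
  apply/hits_infinite => N; have [m [le Hm]] := Ht N; exists m; split=> //.
  by rewrite -label_branch.
move/hits_infinite: Ht => Ht N; have [m [le Hm]] := Ht N; exists m; split=> //.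
by rewrite /stream_label label_branch.
Qed.

Definition tstate := (nat * nat * seq X)%type.
Definition tevent (z : tstate) : event :=
  if z.1.2 < width z.1.1 then Some (label z.1.1 z.1.2 z.2) else None.
Definition temit (z : tstate) : tstate := (z.1.1, z.1.2.+1, z.2).
Definition tread (p : tstate * (X * X)) : tstate :=
  (p.1.1.1.+1, 0, [:: p.2.2, p.2.1 & p.1.2]).

Lemma Comp_tread (I : finType) (f g : I -> X) :
  Comp (fun p : tstate * I => (p.1.1.1.+1, 0, [:: g p.2, f p.2 & p.1.2]) : tstate).
Proof.
apply: Comp_pair; first by apply: Comp_pair; [apply: Comp_succ; comp_proj|exact: Comp_const].
by apply: Comp_cons; [|apply: Comp_cons]; try (apply: Comp_fin); comp_proj.
Qed.

Lemma trajectoryE (s : nat -> X) k :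
  trajectory (0, 0, [::] : seq X) tevent temit tread (fun n => (s n.*2, s n.*2.+1)) k =
  ((clock k, rev (mkseq s (clock k).1.*2)), (clock k).1).
Proof.
elim: k => [|k IH] //; rewrite [LHS]/= IH clockS /tevent.
case: (clock k) => m j /=; case: ltnP => _ //=.
by rewrite !mkseqS !rev_rcons.
Qed.

Lemma Sigma11_reduction : Det (rBCL 1) -> determined L.
Proof.
pose i0 : X * X := (x0, x0).
have C1 : Comp (fun z : tstate => z.1.2 < width z.1.1).
  apply: Comp_leq; first by apply: Comp_succ; comp_proj.
  by rewrite /width; apply: Comp_exp2; apply: Comp_succ; comp_proj.
have CG : Comp (fun z : tstate => if tevent z is Some b then nat_of_bool b else 2).
  have C2 : Comp (fun z : tstate => label z.1.1 z.1.2 z.2) by apply: Comp_label; comp_proj.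
  apply: Comp_ext (Comp_if C1 (Comp_nat_of_bool C2) (Comp_const 2)) _ => z.
  by rewrite /tevent; case: ifP.
have CE : Comp temit.
  by do 2?apply: Comp_pair; try apply: Comp_succ; comp_proj.
have CI := Comp_tread (I := (X * X)%type) fst snd.
have [M HM] := transducer_machine i0 (z0 := (0, 0, [::])) erefl CG CE CI.
apply: (@game_reduction X x0 M pointer (fun s => levels (stream_label s)) L); last exact: pointer_stream.
move=> s z Hz.
have [HU [HL HI]] := HM (fun n => (s n.*2, s n.*2.+1)) z Hz; split.
  move=> N; have [n [_ En]] := HI (start N); exists n; rewrite En trajectoryE.
  by have := @clock_start N 0 isT; rewrite addn0 => ->.
move=> n e /HL ->; rewrite trajectoryE /tevent /levels /=.
by case: (clock _) => m j.
Qed.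
End Reduction.
End NormalForm.

(** * Counters as pushdown stacks *)

Section CounterToPushdown.
Variables (X : finType) (M : rt_counter_aut X 1).
Notation Q := (rca_state M).

Definition delta1 (q : Q) (a : X) (b : bool) (q' : Q) (d : cdir) : Prop :=
  exists (i : {ffun 'I_1 -> bool}) (j : {ffun 'I_1 -> cdir}), [/\ i ord0 = b, j ord0 = d & @rca_delta X 1 M q a i q' j].

(** [option bool] stands in for [cdir] because the candidate transitions have to be enumerated as a
    finite type. *)
Definition dir_of (o : option bool) : cdir :=
  match o with None => CStay | Some true => CInc | Some false => CDec end.
Lemma dir_ofP d : exists o, dir_of o = d.
Proof. by case: d; [exists (Some false)|exists None|exists (Some true)]. Qed.

(* The counter value [c] is represented by the stack [true^c false]. *)
Definition counter_stack (c : nat) : seq bool := nseq c true ++ [:: false].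
Definition push (b : bool) (d : cdir) : seq bool :=
  match d with CDec => if b then [::] else [:: b] | CStay => [:: b] | CInc => [:: true; b] end.

Lemma pushP c d : exists rest, counter_stack c = (c != 0) :: rest /\
  push (c != 0) d ++ rest = counter_stack (cupd c d).
Proof.
by case: c => [|c]; [exists [::]|exists (counter_stack c)]; case: d.
Qed.

(** The transition relation of [M] is an arbitrary proposition; classical decision turns it into the
    required finite list. *)
Definition pd_of_rca : bpda X := @BPDA X Q bool
  [seq (p.1.1.1.1, Some p.1.1.1.2, p.1.1.2, p.1.2, push p.1.1.2 (dir_of p.2)) |
     p <- enum {: Q * X * bool * Q * option bool} &
          `[< delta1 p.1.1.1.1 p.1.1.1.2 p.1.1.2 p.1.2 (dir_of p.2) >]]
  (@rca_init X 1 M) false (@rca_final X 1 M).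

Lemma pd_deltaP q a b q' w :
  (q, a, b, q', w) \in @pd_delta X pd_of_rca <->
  exists x d, [/\ a = Some x, w = push b d & delta1 q x b q' d].
Proof.
split.
  move/mapP => [[[[[q1 x] b1] q1'] o]]; rewrite mem_filter /= => /andP[/asboolP H _] [-> -> -> -> ->].
  by exists x, (dir_of o).
move=> [x [d [-> -> H]]]; have [o Eo] := dir_ofP d.
apply/mapP; exists (q, x, b, q', o); last by rewrite /= Eo.
by rewrite mem_filter mem_enum andbT /= Eo; apply/asboolP.
Qed.

Lemma pd_of_rcaP s : pd_accepts pd_of_rca s <-> rca_accepts M s.
Proof.
split.
- move=> [rq [rs [pos [H1 [H2 [H3 [H4 [_ H6]]]]]]]].
  have Hpos n : pos n = n.
    elim: n => [|n IH] //; have [[_ [Z [rest [w [_ [Hd _]]]]]]|[-> _]] := H4 n; last by rewrite IH.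
    by have /pd_deltaP [x [d []]] := Hd.
  have Hst n c : rs n = counter_stack c -> exists d, rs n.+1 = counter_stack (cupd c d) /\
      delta1 (rq n) (s n) (c != 0) (rq n.+1) d.
    move=> Es; have [[_ [Z [rest [w [_ [Hd _]]]]]]|[_ [Z [rest [w [Ers [Hd Ew]]]]]]] := H4 n.
      by have /pd_deltaP [x [d []]] := Hd.
    have /pd_deltaP [x [d [[Ex] Ep HD]]] := Hd.
    have [rest' [E1 E2]] := pushP c d; move: Ers; rewrite Es E1 => -[EZ Er].
    by exists d; rewrite Ew Ep -EZ -Er E2 -[in s n](Hpos n) Ex EZ.
  pose c n := (size (rs n)).-1.
  have Hc n : rs n = counter_stack (c n).
    suff [k Ek] : exists k, rs n = counter_stack k.
      by rewrite /c Ek size_cat size_nseq addn1.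
    elim: n => [|n [k Ek]]; first by exists 0; rewrite H2.
    by have [d [E _]] := Hst n k Ek; exists (cupd k d).
  exists rq, (fun n _ => c n); split=> //; split=> [m|]; first by rewrite /c H2.
  split=> // n; have [d [E [i [j [Ei Ej HD]]]]] := Hst n (c n) (Hc n).
  exists i, j; split=> // m; rewrite ord1 Ei Ej; split=> //.
  by rewrite /c E size_cat size_nseq addn1.
- move=> [rq [rc [H1 [H2 [H3 H4]]]]].
  exists rq, (fun n => counter_stack (rc n ord0)), id.
  split=> //; split; first by rewrite H2.
  split=> //; split=> [n|]; last by split=> // m; exists m.
  right; split=> //; have [i [j [HD Hij]]] := H3 n; have [Ei Ec] := Hij ord0.
  have [rest [E1 E2]] := pushP (rc n ord0) (j ord0).
  exists (rc n ord0 != 0), rest, (push (rc n ord0 != 0) (j ord0)); split=> //.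
  rewrite Ec E2; split=> //; apply/pd_deltaP; exists (s n), (j ord0); split=> //.
  by exists i, j.
Qed.
End CounterToPushdown.

Lemma rBCL1_CFL (X : finType) (L : olang X) : rBCL 1 L -> CFLw L.
Proof.
by move=> [M HM]; exists (pd_of_rca M) => s; rewrite HM pd_of_rcaP.
Qed.

Lemma pairn_lt a b a' b' : a + b < a' + b' -> pairn a b < pairn a' b'.
Proof.
move=> lt; rewrite !pairnE; have := tri_mono lt; rewrite triS; lia.
Qed.

Lemma pairn_inj a b a' b' : pairn a b = pairn a' b' -> a = a' /\ b = b'.
Proof.
move=> E; case: (ltngtP (a + b) (a' + b')) => [/pairn_lt|/pairn_lt|Es]; rewrite ?E ?ltnn //.
by move: E; rewrite !pairnE Es; lia.
Qed.

Lemma pairn_surj z : exists a b, z = pairn a b.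
Proof.
elim: z => [|z [a [b ->]]]; first by exists 0, 0.
case: a => [|a]; last by exists a, b.+1; rewrite !pairnE addSnnS; lia.
by exists b.+1, 0; rewrite !pairnE add0n !addn0 triS; lia.
Qed.

Lemma code_seq_inj : injective code_seq.
Proof.
by elim=> [|a l IH] [|a' l'] //= [/pairn_inj[-> /IH ->]].
Qed.

Lemma code_seq_surj z : exists l, z = code_seq l.
Proof.
elim/ltn_ind: z => -[|z] IH; first by exists [::].
have [a [b Ez]] := pairn_surj z; have [|l El] := IH b; first by rewrite Ez pairnE; lia.
by exists (a :: l); rewrite /= -El Ez.
Qed.

(** Lists of arbitrary numbers, so that every natural number is the code of exactly one triple; the
    test must give a value on all of them, as [recursive_nat] requires. *)
Definition rawtriple := (nat * (seq nat * seq nat))%type.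

Lemma enc_tripleE n u w :
  enc ((n, (u, w)) : rawtriple) = pairn n (pairn (code_seq u) (code_seq w)).
Proof. by rewrite -[in RHS](map_id u) -[in RHS](map_id w). Qed.

Lemma enc_triple_inj : injective (enc : rawtriple -> nat).
Proof.
move=> [n [u w]] [n' [u' w']]; rewrite !enc_tripleE.
by move=> /pairn_inj [-> /pairn_inj [/code_seq_inj -> /code_seq_inj ->]].
Qed.

Lemma enc_triple_surj z : exists p : rawtriple, z = enc p.
Proof.
have [n [v ->]] := pairn_surj z; have [a [b ->]] := pairn_surj v.
have [u ->] := code_seq_surj a; have [w ->] := code_seq_surj b.
by exists (n, (u, w)); rewrite enc_tripleE.
Qed.

Lemma Sigma11_intro (X : finType) (L : olang X) (test : rawtriple -> bool) : Comp test ->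
  (forall s : oword X, L s <-> exists t : nat -> bool, forall n, exists m,
     test (n, (map nat_of_bool (mkseq t m), map (@code_letter X) (mkseq s m)))) ->
  Sigma11 L.
Proof.
move=> [e He] HL; exists (fun z => exists p, z = enc p /\ test p); split.
  exists e => z; have [p ->] := enc_triple_surj z; split.
    by move=> [p' [E H]]; rewrite (enc_triple_inj E); have := He p'; rewrite H.
  by move=> H; have := He p; case E: (test p) => //; case: H; exists p.
move=> s; rewrite HL; split=> -[t Ht]; exists t => n; have [m Hm] := Ht n; exists m.
  by eexists; split; last exact: Hm; rewrite enc_tripleE.
have [p [Ep Hp]] := Hm; rewrite (_ : (_, _) = p) //; apply: enc_triple_inj.
by rewrite -Ep enc_tripleE.
Qed.

(** * Context-free languages are effective analytic *)

Section PushdownSigma11.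
Variables (X : finType) (M : bpda X).
Notation Q := (pd_state M).
Notation Gam := (pd_stack M).
Notation D := (size (@pd_delta X M)).

(* Some (q, k): state [q], after reading [k] bits [1]; a bit [0] then fires transition [k]. *)
Definition control : finType := option (Q * 'I_D.+1).
(* control, stack, number of letters read, number of final states entered *)
Definition sstate := (control * (seq Gam * (nat * nat)))%type.

Definition fire (q : Q) (k : nat) (Z : option Gam) (a : option X) : option (Q * bool * seq Gam) :=
  if onth (@pd_delta X M) k is Some (q1, a1, Z1, q2, v) then
    if [&& q1 == q, Z == Some Z1 & (a1 == None) || (a1 == a)] then Some (q2, isSome a1, v) else None
  else None.

Definition score (p : sstate) (b : bool) (x : option X) : sstate * bool :=
  match p.1 with
  | None => (p, false)
  | Some (q, k) =>
    (* An overlong block of ones wraps around to 0 by [inord]; this is harmless, since [fire] only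
       lets an applicable transition through. *)
    if b then ((Some (q, inord k.+1), p.2), false) else
    match fire q k (ohead p.2.1) x with
    | None => ((None, p.2), false)
    | Some (q', used, v) =>
      ((Some (q', ord0), (v ++ behead p.2.1, (p.2.2.1 + used, p.2.2.2 + (q' \in @pd_final X M)))), used)
    end
  end.

Definition sinit : sstate := (Some (@pd_init X M, ord0), ([:: @pd_bottom X M], (0, 0))).

Definition decode (v : nat) : option X := nth None (map Some (enum X)) v.

Definition sstep (p : sstate * seq nat) (b : nat) : sstate * seq nat :=
  let r := score p.1 (b != 0) (obind decode (ohead p.2)) in
  (r.1, if r.2 then behead p.2 else p.2).

(** Asking for [n] letters ensures that the whole word is read. As a bit consumes at most one
    letter, it also makes the test succeed at arbitrarily late times, and since [None] is never
    left, the simulated run is then never blocked. *)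
Definition stest (z : rawtriple) : bool :=
  let r := (foldl sstep (sinit, z.2.2) z.2.1).1 in
  [&& r.1 != None, z.1 <= r.2.2.1 & z.1 <= r.2.2.2].

#[local] Instance enc_control : Enc control := @enc_fin control.
#[local] Instance enc_letter : Enc (option X) := @enc_fin (option X).
#[local] Instance enc_Gam : Enc Gam := @enc_fin Gam.
#[local] Instance enc_oGam : Enc (option Gam) := @enc_fin (option Gam).

(** Once control, top of the stack and letter are fixed, [fire] and [inord] are constants;
    [Comp_case] then restores the dependence on these finite data. *)
Lemma Comp_score : Comp (fun p : sstate * (bool * option X) => score p.1 p.2.1 p.2.2).
Proof.
have Cst : Comp (fun p : sstate * (bool * option X) => p.1.2.1) by comp_proj.
have Chead : Comp (fun p : sstate * (bool * option X) => ohead p.1.2.1).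
  have C1 : Comp (fun q : (sstate * (bool * option X)) * (Gam * seq Gam) => Some q.2.1).
    by apply: (Comp_fin (@Some Gam)); comp_proj.
  by apply: (Comp_ext (Comp_seqcase Cst (Comp_const None) C1)) => p; case: (p.1.2.1).
have Ctail : Comp (fun p : sstate * (bool * option X) => behead p.1.2.1).
  have C1 : Comp (fun q : (sstate * (bool * option X)) * (Gam * seq Gam) => q.2.2) by comp_proj.
  by apply: (Comp_ext (Comp_seqcase Cst (Comp_const [::]) C1)) => p; case: (p.1.2.1).
have Cl : Comp (fun p : sstate * (bool * option X) => p.2.2) by comp_proj.
pose F (c : control) (Z : option Gam) (x : option X) (p : sstate * (bool * option X)) :=
  match c with
  | None => (p.1, false)
  | Some (q, k) =>
    if p.2.1 then ((Some (q, inord k.+1) : control, p.1.2), false) else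
    match fire q k Z x with
    | None => ((None : control, p.1.2), false)
    | Some (q', used, v) =>
      ((Some (q', ord0) : control, (v ++ behead p.1.2.1, (p.1.2.2.1 + used, p.1.2.2.2 + (q' \in @pd_final X M)))), used)
    end
  end.
have CF c Z x : Comp (F c Z x).
  rewrite /F; case: c => [[q k]|]; last by apply: Comp_pair; [comp_proj|exact: Comp_const].
  apply: Comp_if; first by comp_proj.
    by apply: Comp_pair; [apply: Comp_pair; [exact: Comp_const|comp_proj]|exact: Comp_const].
  case: (fire _ _ _ _) => [[[q' used] v]|]; last first.
    by apply: Comp_pair; [apply: Comp_pair; [exact: Comp_const|comp_proj]|exact: Comp_const].
  apply: Comp_pair; last exact: Comp_const.
  apply: Comp_pair; first exact: Comp_const.
  apply: Comp_pair.
    apply: Comp_ext (Comp_catrev (Comp_const (rev v)) Ctail) _ => p.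
    by rewrite catrevE revK.
  by apply: Comp_pair; apply: Comp_add; try exact: Comp_const; comp_proj.
have C3 : Comp (fun p : sstate * (bool * option X) => F p.1.1 (ohead p.1.2.1) p.2.2 p); last first.
  by apply: (Comp_ext C3) => -[[c [st [m n]]] [b y]].
apply: (@Comp_case _ _ _ _ (option X) (fun p => p.2.2)
  (fun x p => F p.1.1 (ohead p.1.2.1) x p)) => // x.
apply: (@Comp_case _ _ _ _ (option Gam) (fun p => ohead p.1.2.1) (fun Z p => F p.1.1 Z x p)) => // Z.
apply: (@Comp_case _ _ _ _ control (fun p => p.1.1) (fun c p => F c Z x p)) => //.
by comp_proj.
Qed.

Lemma Comp_stest : Comp stest.
Proof.
have Cw0 : Comp (fun p : rawtriple * ((sstate * seq nat) * nat) => p.2.1.2) by comp_proj.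
have Cstep : Comp (fun p : rawtriple * ((sstate * seq nat) * nat) => sstep p.2.1 p.2.2).
  have Clet : Comp (fun p : rawtriple * ((sstate * seq nat) * nat) => obind decode (ohead p.2.1.2)).
    have C1 : Comp (fun q : (rawtriple * ((sstate * seq nat) * nat)) * (nat * seq nat) => decode q.2.1).
      by apply: Comp_nth; comp_proj.
    by apply: (Comp_ext (Comp_seqcase Cw0 (Comp_const None) C1)) => p; case: (p.2.1.2).
  have Cbit : Comp (fun p : rawtriple * ((sstate * seq nat) * nat) => p.2.2 != 0).
    by apply: Comp_nz; comp_proj.
  have Cst : Comp (fun p : rawtriple * ((sstate * seq nat) * nat) => p.2.1.1) by comp_proj.
  have Cr := Comp_comp Comp_score (Comp_pair Cst (Comp_pair Cbit Clet)).
  apply: Comp_pair; first exact: (Comp_fst Cr).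
  apply: Comp_if; [exact: (Comp_snd Cr)| |by comp_proj].
  have C1 : Comp (fun q : (rawtriple * ((sstate * seq nat) * nat)) * (nat * seq nat) => q.2.2) by comp_proj.
  by apply: (Comp_ext (Comp_seqcase Cw0 (Comp_const [::]) C1)) => p; case: (p.2.1.2).
have Cu : Comp (fun z : rawtriple => z.2.1) by comp_proj.
have Cw : Comp (fun z : rawtriple => z.2.2) by comp_proj.
have Cr := Comp_fst (Comp_foldl Cu (Comp_pair (Comp_const sinit) Cw) Cstep).
have Cn : Comp (fun z : rawtriple => z.1) by comp_proj.
have C1 : Comp (fun z : rawtriple => (foldl sstep (sinit, z.2.2) z.2.1).1.1 != None).
  exact: (Comp_fin (fun c : control => c != None) (Comp_fst Cr)).
have C2 := Comp_leq Cn (Comp_fst (Comp_snd (Comp_snd Cr))).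
have C3 := Comp_leq Cn (Comp_snd (Comp_snd (Comp_snd Cr))).
apply: Comp_ext (Comp_if C1 (Comp_if C2 C3 (Comp_const false)) (Comp_const false)) _ => z.
by rewrite /stest /=; do 2?case: ifP.
Qed.

Section Run.
Variables (s : nat -> X) (t : nat -> bool).

Fixpoint srun (i : nat) : sstate :=
  if i is j.+1 then let p := srun j in (score p (t j) (Some (s p.2.2.1))).1 else sinit.

Lemma score_used p b x : (score p b x).1.2.2.1 = p.2.2.1 + (score p b x).2.
Proof.
rewrite /score; case: p.1 => [[q k]|]; rewrite ?addn0 //.
case: b; rewrite ?addn0 //; case: (fire _ _ _ _) => [[[q' used] v]|] //=; by rewrite addn0.
Qed.

(** Hence the first [m] letters suffice for the first [m] bits. *)
Lemma srun_le i : (srun i).2.2.1 <= i.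
Proof. by elim: i => //= i IH; rewrite score_used -[i.+1]addn1 leq_add // leq_b1. Qed.

Lemma decode_letter x : decode (code_letter x) = Some x.
Proof.
by rewrite /decode /code_letter (nth_map x) ?nth_enum_rank // -cardE; exact: ltn_ord.
Qed.

Lemma foldl_srun m i : i <= m ->
  foldl sstep (sinit, map (@code_letter X) (mkseq s m)) (map nat_of_bool (mkseq t i)) =
  (srun i, drop (srun i).2.2.1 (map (@code_letter X) (mkseq s m))).
Proof.
elim: i => [|i IH] lt; first by rewrite drop0.
rewrite mkseqS map_rcons foldl_rcons IH ?(ltnW lt) // /sstep /=.
have lt' : (srun i).2.2.1 < m by apply: leq_ltn_trans (srun_le i) lt.
have -> : obind decode (ohead (drop (srun i).2.2.1 (map (@code_letter X) (mkseq s m)))) =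
    Some (s (srun i).2.2.1).
  rewrite -map_comp (drop_nth 0) ?size_map ?size_iota // [LHS]/(decode _).
  by rewrite (nth_map 0) ?size_iota // nth_iota //; exact: decode_letter.
have -> : (t i : nat) != 0 = t i by case: (t i).
rewrite score_used; case: (score _ _ _) => [p [|]] /=; last by rewrite addn0.
by rewrite -[X in behead X]/(drop _ _) -drop1 drop_drop addnC.
Qed.

Lemma stestE n m :
  stest (n, (map nat_of_bool (mkseq t m), map (@code_letter X) (mkseq s m))) =
  [&& (srun m).1 != None, n <= (srun m).2.2.1 & n <= (srun m).2.2.2].
Proof. by rewrite /stest foldl_srun. Qed.

End Run.

Lemma fireP q k Z rest x q' used v :
  fire q k (Some Z) (Some x) = Some (q', used, v) ->
  pd_step (if used then Some x else None) q (Z :: rest) q' (v ++ rest).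
Proof.
rewrite /fire; case E: (onth _ k) => [[[[[q1 a1] Z1] q2] v1]|] //.
case: ifP => // /and3P[/eqP Eq /eqP[EZ] Ea] [E1 E2 E3]; subst.
exists Z1, rest, v; split=> //; split=> //.
by apply/onthP; exists k; move: Ea E => /orP[/eqP->|/eqP->].
Qed.


Lemma fire_complete q q' Z rest st' (used : bool) x :
  pd_step (if used then Some x else None) q (Z :: rest) q' st' ->
  exists2 k, k < D & exists v, fire q k (Some Z) (Some x) = Some (q', used, v) /\ st' = v ++ rest.
Proof.
move=> [Z1 [rest1 [v [[EZ Er] [/onthP[k Ek] ->]]]]]; subst Z1 rest1; exists k.
  by rewrite -onthTE Ek.
by exists v; rewrite /fire Ek !eqxx /=; case: (used) => //=; rewrite eqxx.
Qed.

Lemma pd_to_sim (s : nat -> X) : pd_accepts M s ->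
  exists t, forall n, exists m,
    [&& (srun s t m).1 != None, n <= (srun s t m).2.2.1 & n <= (srun s t m).2.2.2].
Proof.
move=> [rq [rs [pos [H1 [H2 [H3 [H4 [H5 H6]]]]]]]].
have tr n : exists k, k < D /\ exists v (used : bool), [/\ pos n.+1 = pos n + used,
    fire (rq n) k (ohead (rs n)) (Some (s (pos n))) = Some (rq n.+1, used, v) &
    rs n.+1 = v ++ behead (rs n)].
  have [used [Ep St]] : exists used : bool, pos n.+1 = pos n + used /\
      pd_step (if used then Some (s (pos n)) else None) (rq n) (rs n) (rq n.+1) (rs n.+1).
    by case: (H4 n) => -[-> St]; [exists false; rewrite addn0|exists true; rewrite addn1].
  have [Z [rest [w [Es _]]]] := St; rewrite Es in St *.
  by have [k lt [v [Ef Ev]]] := fire_complete St; exists k; split=> //; exists v, used.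
have [k Hk] := choice tr.
(* The bits of [t] are blocks of [k n] ones closed by a zero; [clk i] gives the block containing bit
   [i] and the number of ones left in it. *)
pose fix clk i : nat * nat := if i is j.+1 then
  let: (n, r) := clk j in if r is r'.+1 then (n, r') else (n.+1, k n.+1) else (0, k 0).
(* As in [score], only states entered by a transition are counted, so [rq 0] is left out. *)
pose fins := fix fins n := if n is n'.+1 then fins n' + (rq n \in @pd_final X M) else 0.
pose t i := (clk i).2 != 0; exists t => N.
have sim i : (clk i).2 <= k (clk i).1 /\
    srun s t i = (Some (rq (clk i).1, inord (k (clk i).1 - (clk i).2)),
                  (rs (clk i).1, (pos (clk i).1, fins (clk i).1))).
  elim: i => [|i [IHr IH]].
    split=> //=; rewrite subnn /sinit H1 H2 H3; congr (Some (_, _), _).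
    by apply: val_inj; rewrite /= inordK.
  rewrite [srun _ _ i.+1]/= IH /t [clk i.+1]/=; case: (clk i) IHr => n [|r] /= le.
    rewrite subn0 /score /= inordK ?ltnS; last by have [/ltnW] := Hk n.
    have [lt [v [used [Ep Ef Es]]]] := Hk n; rewrite Ef leqnn subnn Es Ep /=; split=> //.
    by congr (Some (_, _), _); apply: val_inj; rewrite /= inordK.
  have [lt _] := Hk n.
  split; first exact: ltnW; rewrite /score /=; congr (Some (_, _), _).
  by rewrite inordK; [congr inord; lia|lia].
have reach n : exists i, clk i = (n, k n).
  elim: n => [|n [i Ei]]; first by exists 0.
  have run d : d <= k n -> clk (i + d) = (n, k n - d).
    elim: d => [|d IH] lt; first by rewrite addn0 subn0.
    by rewrite addnS /= IH ?(ltnW lt) // -(subnSK lt).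
  by exists (i + k n).+1; rewrite /= run // subnn.
have posS n m : n <= m -> pos n <= pos m.
  move=> /subnK <-; elim: (m - n) => // d IH; rewrite addSn; apply: leq_trans IH _.
  by have [_ [v [used [-> _ _]]]] := Hk (d + n); exact: leq_addr.
have finsS n m : n <= m -> fins n <= fins m.
  by move=> /subnK <-; elim: (m - n) => // d IH; rewrite addSn /=; exact: leq_trans IH (leq_addr _ _).
have finsU : exists n, N <= fins n.
  elim: N => [|N' [n le]]; first by exists 0.
  have [[|m] [lem Hm]] := H6 n.+1; first by [].
  have le' : N' <= fins m by apply: leq_trans le _; exact: finsS.
  by exists m.+1; rewrite (_ : fins m.+1 = (fins m).+1) //= Hm addn1.
have [n1 le1] := H5 N; have [n2 le2] := finsU.
have [i Ei] := reach (maxn n1 n2); exists i; have [_ ->] := sim i.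
rewrite Ei /= (leq_trans le1 (posS _ _ (leq_maxl _ _))).
exact: leq_trans le2 (finsS _ _ (leq_maxr _ _)).
Qed.

Lemma sim_to_pd (s : nat -> X) t :
  (forall n, exists m,
    [&& (srun s t m).1 != None, n <= (srun s t m).2.2.1 & n <= (srun s t m).2.2.2]) ->
  pd_accepts M s.
Proof.
move=> H; set g := srun s t.
have gS i : g i.+1 = (score (g i) (t i) (Some (s (g i).2.2.1))).1 by [].
have alive i : (g i).1 != None.
  have [m /and3P[Hm le _]] := H i; have lei := leq_trans le (srun_le s t m).
  move: Hm; rewrite -/(g m); move: lei => /subnK <-; elim: (m - i) => // d IH.
  by rewrite addSn gS => Hm; apply: IH; apply: contra Hm => /eqP E; rewrite /score E /= E.
pose st i := if (g i).1 is Some (q, _) then q else @pd_init X M.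
pose p i := ~~ t i.
have ones i : t i -> [/\ st i.+1 = st i & (g i.+1).2 = (g i).2].
  by move=> ti; rewrite /st gS ti /score; case E: (g i).1 => [[q k]|]; rewrite /= ?E.
have zeros i : p i -> exists k v (used : bool),
    [/\ fire (st i) k (ohead (g i).2.1) (Some (s (g i).2.2.1)) = Some (st i.+1, used, v) &
     (g i.+1).2 = (v ++ behead (g i).2.1, ((g i).2.2.1 + used,
        (g i).2.2.2 + (st i.+1 \in @pd_final X M)))].
  rewrite /p /st => /negbTE ti; have := alive i.+1; rewrite gS ti /score.
  case E: (g i).1 => [[q k]|] /=; last by rewrite E.
  by case Ef: (fire _ _ _ _) => [[[q' used] v]|] //= _; exists k, v, used.
have U : forall N, exists n, N <= kount p n.
  move=> N; have [m /and3P[_ le _]] := H N; exists m; apply: leq_trans le _; rewrite -/(g m).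
  elim: m => [|m IH] //; rewrite [kount p _]/=; case pm: (p m); last first.
    by rewrite addn0; have [|_ ->] := ones m; first exact: negbFE.
  have [k [v [used [_ ->]]]] := zeros m pm.
  by rewrite leq_add // leq_b1.
have idle i j : kount p i = kount p j -> st i = st j /\ (g i).2 = (g j).2.
  wlog le : i j / i <= j => [W|].
    by case: (leqP i j) => [|/ltnW] le E; [apply: W|have [] := W j i le (esym E)].
  elim: j le => [|j IH] le E; first by have -> : i = 0 by lia.
  case: (ltngtP i j.+1) le => // [lt _|-> //].
  have le1 := kount_mono p (lt : i <= j).
  have pj : p j = false by move: E; rewrite /=; case: (p j) => //; lia.
  have [|-> ->] := IH lt; first by move: E; rewrite /= pj addn0.
  by have [|-> ->] := ones j; first by move: pj; rewrite /p => /negbFE.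
(* The steps of the pushdown run are the zeros of [t]: [pos n] is the zero of rank [n]. *)
have [pos Hpos] := choice (kount_pos U).
have kposS n : kount p (pos n).+1 = kount p (pos n.+1).
  by have [/= -> ->] := Hpos n; have [_ ->] := Hpos n.+1; rewrite addn1.
have stS n := idle _ _ (kposS n).
have at0 := idle (pos 0) 0 (Hpos 0).2.
exists (fun n => st (pos n)), (fun n => (g (pos n)).2.1), (fun n => (g (pos n)).2.2.1).
have [-> ->] := at0; split=> //; split=> //; split=> //; split; last split.
- move=> n; have [Hp _] := Hpos n; have [<- <-] := stS n.
  have [k [v [used [Ef ->]]]] := zeros _ Hp.
  case Es: (g (pos n)).2.1 Ef => [|Z rest] /= Ef; first by move: Ef; rewrite /fire; case: (onth _ _) => [[[[[? ?] ?] ?] ?]|] //; rewrite andbF.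
  have := fireP rest Ef; case: used {Ef} => St; [right|left]; by rewrite ?addn1 ?addn0.
- move=> m; have [i /and3P[_ le _]] := H m; exists (kount p i).
  by have [|_ ->] := idle (pos (kount p i)) i; rewrite ?(Hpos _).2.
- move=> N; apply: contrapT => nH.
  (* If no final state occurred from rank [N] on, the number of final states entered would stay
     bounded, against the test for a large [n]. *)
  have no i : N <= kount p i -> (g i).2.2.2 <= (g (pos N)).2.2.2.
    elim: i => [|i IH]; first by rewrite leqn0 => /eqP ->; have [_ ->] := at0.
    rewrite /=; case pi: (p i); last first.
      by rewrite addn0 => /IH; have [|_ ->] := ones i; first by move/negbFE: pi.
    have [k [v [used [_ ->]]]] := zeros i pi; rewrite addn1 /= => le.
    case: (ltngtP N (kount p i).+1) le => // [lt _|Ek _].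
      have -> : (st i.+1 \in @pd_final X M) = false; last by rewrite addn0; exact: IH.
      apply/negP => Hf; apply: nH; exists (kount p i).+1; split; first exact: ltnW.
      by have [|-> _] := idle (pos (kount p i).+1) i.+1; rewrite ?(Hpos _).2 //= pi addn1.
    have [|_ ->] := idle (pos N) i.+1; first by rewrite (Hpos _).2 /= pi addn1.
    by have [k' [v' [used' [_ ->]]]] := zeros i pi; rewrite /=.
  have [m /and3P[_ le1 le2]] := H (N + (g (pos N)).2.2.2).+1.
  have : N <= kount p m \/ kount p m < N by lia.
  case=> [/no|lt]; first by move: le2; rewrite -/(g m); lia.
  have mono d : (g m).2.2.2 <= (g (m + d)).2.2.2.
    elim: d => [|d IH]; first by rewrite addn0.
    rewrite addnS; apply: leq_trans IH _; case td: (t (m + d)); first by have [_ ->] := ones _ td.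
    have [|k [v [used [_ ->]]]] := zeros (m + d); first by rewrite /p td.
    exact: leq_addr.
  have lt' : m <= pos N.
    rewrite leqNgt; apply/negP => /ltnW /(kount_mono p); rewrite (Hpos N).2; lia.
  by have := mono (pos N - m); rewrite subnKC // => le3; move: le2; rewrite -/(g m); lia.
Qed.

Lemma CFL_Sigma11 L : (forall s, L s <-> pd_accepts M s) -> Sigma11 L.
Proof.
move=> HL; apply: (Sigma11_intro Comp_stest) => s; rewrite HL; split.
  by move=> /pd_to_sim[t Ht]; exists t => n; have [m Hm] := Ht n; exists m; rewrite stestE.
by move=> [t Ht]; apply: (@sim_to_pd s t) => n; have [m Hm] := Ht n; exists m; rewrite -stestE.
Qed.

End PushdownSigma11.

Theorem theorem3p4 :
  (Det Sigma11 <-> Det CFLw) /\ (Det CFLw <-> Det (rBCL 1)).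
Proof.
have SC : Det Sigma11 -> Det CFLw.
  by move=> H X iX L [M HM]; apply: (H X iX); exact: CFL_Sigma11 HM.
have CB : Det CFLw -> Det (rBCL 1).
  by move=> H X iX L HL; apply: (H X iX); exact: rBCL1_CFL.
have BS : Det (rBCL 1) -> Det Sigma11.
  move=> H X [x0] L [R [recR HR]]; exact: (Sigma11_reduction recR x0 HR H).
by split; split; auto.
Qed.
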